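(* Let $n$ be an even positive integer. Then $\overline{a_3^s}(n)\leq \left\lfloor \frac{n(n-7/3)}{3}\right\rfloor$.
   Context: An affine pseudo-line is a curve $\Gamma\subset\mathbb{R}^2$ such that there is a homeomorphism $\phi:\mathbb{R}^2\to\mathbb{R}^2$ with $\phi(\Gamma)$ a straight line. An affine arrangement of $n$ pseudo-lines is a set of $n$ affine pseudo-lines such that any two of them intersect in exactly one point; it is simple if no point lies on three or more of them. A triangle of an affine arrangement is a bounded connected component of the complement of the union of the pseudo-lines whose boundary is formed by exactly three of the pseudo-lines. $\overline{a_3^s}(n)$ denotes the maximum number of triangles of a simple affine arrangement of $n$ pseudo-lines.
   Formalization: The case n = 2 is excluded, since there the bound is −1 while the maximum is 0; and two pseudo-lines meeting in exactly one point are required to cross there, since with tangencies four pseudo-lines can form three triangles while the bound is 2. *)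

(* Defs.v *)
From mathcomp Require Import all_boot all_order all_algebra.
From mathcomp Require Import all_classical all_reals all_analysis.
Set Implicit Arguments.
Unset Strict Implicit.
Unset Printing Implicit Defensive.
Import Order.TTheory GRing.Theory Num.Theory.
Import numFieldNormedType.Exports.
Local Open Scope classical_set_scope.
Local Open Scope ring_scope.

Definition homeomorphism (T U : topologicalType) (f : T -> U) : Prop :=
  continuous f /\
  exists g : U -> T, [/\ continuous g, cancel f g & cancel g f].

Definition boundary (T : topologicalType) (A : set T) : set T :=
  closure A `\` interior A.

Definition straight_line (R : realType) (L : set (R * R)) : Prop :=
  exists a b c : R, (a, b) != (0, 0) /\
    L = [set p : R * R | a * p.1 + b * p.2 = c].

Definition affine_pseudoline (R : realType) (G : set (R * R)) : Prop :=
  exists phi : R * R -> R * R, homeomorphism phi /\ straight_line (phi @` G).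

(* H passes from one side of G to the other. *)
Definition crosses (R : realType) (G H : set (R * R)) : Prop :=
  exists x y : R * R, [/\ H x, H y, ~ G x, ~ G y &
    ~ connected_component (~` G) x y].

(* Meeting "in exactly one point" is meant, as usual for pseudo-lines, as
   crossing there; mere tangencies, such as that of a parabola and the
   tangent at its apex, are excluded.  Four curves that may touch can
   bound three triangles, but four that cross bound at most two. *)
Definition affine_arrangement (R : realType) (n : nat)
    (A : set (set (R * R))) : Prop :=
  [/\ (A #= `I_n)%card,
      forall G, A G -> affine_pseudoline G &
      forall G H, A G -> A H -> G <> H ->
        (exists! p, G p /\ H p) /\ crosses G H].

Definition simple_arrangement (R : realType) (A : set (set (R * R))) : Prop :=
  forall G H K, A G -> A H -> A K -> G <> H -> H <> K -> G <> K ->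
    G `&` H `&` K = set0.

Definition face (R : realType) (A : set (set (R * R))) (C : set (R * R)) :
    Prop :=
  let U := \bigcup_(G in A) G in
  exists2 x, ~ U x & C = connected_component (~` U) x.

(* G contributes an edge to the boundary of C, as opposed to merely passing
   through one of its vertices: some boundary point of C lies on G alone. *)
Definition side (R : realType) (A : set (set (R * R))) (C G : set (R * R)) :
    Prop :=
  A G /\ exists p, [/\ boundary C p, G p & forall H, A H -> H p -> H = G].

Definition triangle (R : realType) (A : set (set (R * R))) (C : set (R * R)) :
    Prop :=
  [/\ face A C, bounded_set C & (side A C #= `I_3)%card].

(* The maximum is taken as a supremum in the extended reals, and an infinite
   set has [counting] +oo, so that no existence or finiteness is presupposed. *)
Definition max_triangles (R : realType) (n : nat) : \bar R :=
  ereal_sup [set counting (triangle A) | A in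
    [set A : set (set (R * R)) | affine_arrangement n A /\ simple_arrangement A]].

(* Main.v *)
(** Each pseudo-line is the zero set of the height [ht i] of a chart of the
    plane, and its vertices, the crossings with the other lines, cut it into
    [n - 2] bounded segments and two rays.  A face that touches a line next to
    a vertex fills the quadrant there, so it also touches the other line; a
    triangle over a segment therefore has its apex at the crossing of the two
    lines through the ends of that segment.  As this crossing lies on one side
    only, a segment borders at most one triangle, and consecutive segments of a
    line border triangles on opposite sides of it.

    If all the segments of a line [i] border triangles, these alternate, and
    for [n] even the first and the last one are on opposite sides of [i].  Let
    [l] and [r] be the lines through the extreme vertices of [i].  Past [i], on
    the side away from the extreme triangle, neither [l] nor [r] starts with a
    segment bordering a triangle, and these cannot both be rays, because [l]
    and [r] cross.  So [i] passes through an end of an unused bounded segment.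
    A segment has two ends and lies on one line, whence there are at least
    [n / 3] unused segments, and [T] triangles, each with three segments of its
    own, satisfy [3 T <= n (n - 2) - n / 3]. *)

From mathcomp Require Import all_boot all_order all_algebra.
From mathcomp Require Import all_classical all_reals all_analysis.
From mathcomp Require Import ring lra zify.
Require Import Defs.
Set Implicit Arguments.
Unset Strict Implicit.
Unset Printing Implicit Defensive.
Import Order.TTheory GRing.Theory Num.Theory.
Import numFieldNormedType.Exports.
Local Open Scope classical_set_scope.
Local Open Scope ring_scope.

(** * Continuous functions and paths *)

(** The 0-1 indicator of [P] is continuous on the segment and never equal to 1/2, so the
    intermediate value theorem forbids a change of truth value. This is how properties are carried
    along a line. *)
Lemma locally_constant_segment (R : realType) (P : R -> Prop) (a b : R) :
  a <= b ->
  (forall x, a <= x <= b ->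
     exists2 r : R, 0 < r & forall y, `|y - x| < r -> (P x <-> P y)) ->
  P a <-> P b.
Proof.
move=> ab lcP; pose f (x : R) : R := if `[< P x >] then 1 else 0.
have f_cont : {within `[a, b], continuous f}.
  apply: continuous_in_subspaceT => x; rewrite inE /= in_itv /= => xab.
  have [r r0 hr] := lcP x xab.
  apply: (@near_cst_continuous _ _ (f x)).
  apply/nbhs_ballP; exists r => //= y; rewrite /ball /= distrC => /hr Pxy.
  rewrite /f; case: asboolP => Py; case: asboolP => Px //.
    by case: Px; apply/Pxy.
  by case: Py; apply/Pxy.
have half : ~ exists2 c, c \in `[a, b] & f c = 2^-1.
  by case=> c _; rewrite /f; case: ifP => _ e; lra.
split=> [Pa|Pb]; apply: contrapT => nP; apply: half; apply: IVT => //; rewrite /f.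
  by rewrite asboolT // asboolF //; apply/andP; split;
    rewrite ?ge_min ?le_max; apply/orP; [right|left]; lra.
by rewrite asboolF // asboolT //; apply/andP; split;
  rewrite ?ge_min ?le_max; apply/orP; [left|right]; lra.
Qed.

Lemma continuous_neq0_gt0 (R : realType) (g : R -> R) (a b : R) :
  continuous g -> a <= b -> (forall x, a <= x <= b -> g x != 0) ->
  0 < g a * g b.
Proof.
move=> gc ab gN0.
have ga0 := gN0 a; have gb0 := gN0 b.
rewrite lexx ab /= in ga0; rewrite lexx ab /= in gb0.
move: (ga0 isT) (gb0 isT) => {ga0 gb0} ga0 gb0.
have [//|gab] := ltP 0 (g a * g b).
have [||c] := @IVT R g a b 0 ab.
- by apply: continuous_subspaceT.
- move: gab; rewrite ge_min le_max; case: (ltgtP (g a) 0) ga0 => // ga _ gab;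
    rewrite ?(ltW ga) ?orbT /= ?andbT.
  + by rewrite -(nmulr_rle0 _ ga).
  + by rewrite -(pmulr_rle0 _ ga).
- by rewrite in_itv /= => cab gc0; have := gN0 c cab; rewrite gc0 eqxx.
Qed.

Lemma continuous_neq0_near (R : realType) (g : R -> R) (x : R) :
  continuous g -> g x != 0 ->
  exists2 r : R, 0 < r & forall y, `|y - x| < r -> 0 < g x * g y.
Proof.
move=> gc gx.
have : \forall y \near x, 0 < g x * g y.
  have gxx : g x * g y @[y --> x] --> g x * g x.
    by apply: cvgM; [exact: cvg_cst|exact: gc].
  by apply: (cvgr_gt _ gxx); rewrite -expr2 exprn_even_gt0.
by move=> /nbhs_ballP[r r0 hr]; exists r => // y yx; apply: hr; rewrite /ball /= distrC.
Qed.

Lemma first_zero (R : realType) (g : R -> R) :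
  continuous g -> g 0 != 0 -> g 1 = 0 ->
  exists t, [/\ 0 < t, t <= 1, g t = 0 &
    forall s, 0 <= s -> s < t -> 0 < g 0 * g s].
Proof.
move=> gc g0 g1.
pose P (x : R) := exists2 y, 0 <= y <= x & g y = 0.
suff [x x01 [gx0 xfirst]] : exists2 x, 0 <= x <= 1 &
    g x = 0 /\ forall y, 0 <= y -> y < x -> g y != 0.
  case/andP: x01 => x0 x1; exists x; split=> //.
    by rewrite lt_neqAle x0 andbT; apply: contra_neq g0 => x_0; rewrite [in LHS]x_0.
  move=> s s0 sx; apply: continuous_neq0_gt0 => // y /andP[y0 ys].
  by apply: xfirst => //; apply: le_lt_trans sx.
apply: contrapT => nofirst.
have nP0 : ~ P 0.
  by move=> [y y0 gy]; move: g0; rewrite (_ : 0 = y) ?gy ?eqxx //; lra.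
have P1 : P 1 by exists 1 => //; lra.
(* Without a first zero [P] is locally constant: at a zero of [g] an earlier zero serves all nearby
   points, and elsewhere [g] does not vanish nearby. *)
apply: nP0; apply: (iffRL (locally_constant_segment ler01 _) P1) => x x01.
have [gx|gx] := eqVneq (g x) 0.
  have [[y [yx y0 gy]]|noy] := pselect (exists y, [/\ y < x, 0 <= y & g y = 0]).
    exists (x - y) => [|z]; first by rewrite subr_gt0.
    rewrite ltr_norml => zx; split=> _; exists y => //; lra.
  case: nofirst; exists x => //; split=> // y y0 yx.
  by apply/eqP => gy; apply: noy; exists y.
have [r r0 hr] := continuous_neq0_near gc gx; exists r => // y yx.
have gN0 z : `|z - x| < r -> g z <> 0.
  by move=> /hr + gz; rewrite gz mulr0 ltxx.
move: yx; rewrite ltr_norml => yx.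
split=> -[z zy gz]; exists z => //; have := @gN0 z; rewrite ltr_norml => {}gN0;
  apply/andP; split; try lra; rewrite leNgt; apply/negP => zlt; apply: gN0 => //;
  lra.
Qed.

Lemma convex_lt (R : realType) (a b c s : R) :
  0 <= s <= 1 -> a < c -> b < c -> a + s * (b - a) < c.
Proof.
move=> /andP[s0 s1] ac bc; have [ab|ba] := leP a b.
  have : 0 <= (1 - s) * (b - a) by rewrite mulr_ge0 // subr_ge0.
  lra.
have : 0 <= s * (a - b) by rewrite mulr_ge0 // subr_ge0 ltW.
lra.
Qed.

Lemma convex_gt (R : realType) (a b c s : R) :
  0 <= s <= 1 -> c < a -> c < b -> c < a + s * (b - a).
Proof.
move=> s01 ca cb; have := @convex_lt R (- a) (- b) (- c) s s01.
by rewrite !ltrN2 => /(_ ca cb); lra.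
Qed.

Definition segment_path (R : realType) (p q : R * R) (t : R) : R * R :=
  (p.1 + t * (q.1 - p.1), p.2 + t * (q.2 - p.2)).

Lemma segment_path_continuous (R : realType) (p q : R * R) :
  continuous (segment_path p q).
Proof.
move=> t.
have affine_cvg (x y : R) : x + s * (y - x) @[s --> t] --> x + t * (y - x).
  by apply: cvgD; [exact: cvg_cst|apply: cvgM; [exact: cvg_id|exact: cvg_cst]].
exact: cvg_pair (affine_cvg p.1 q.1) (affine_cvg p.2 q.2).
Qed.

Lemma segment_path0 (R : realType) (p q : R * R) : segment_path p q 0 = p.
Proof. by case: p => x y; rewrite /segment_path /= !mul0r !addr0. Qed.

Lemma segment_path1 (R : realType) (p q : R * R) : segment_path p q 1 = q.
Proof. by case: q => x y; rewrite /segment_path /=; congr (_, _); ring. Qed.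

Lemma component_path (R : realType) (A : set (R * R)) (x : R * R)
    (gamma : R -> R * R) (a b : R) :
  continuous gamma -> a <= b -> (forall t, a <= t <= b -> A (gamma t)) ->
  connected_component A x (gamma a) -> connected_component A x (gamma b).
Proof.
move=> gc ab gA xa; apply: (connected_component_trans xa).
exists (gamma @` `[a, b]); last by exists b => //=; rewrite in_itv /= ab lexx.
split.
- by exists a => //=; rewrite in_itv /= ab lexx.
- by move=> _ [t /= + <-]; rewrite in_itv /=; exact: gA.
- apply: connected_continuous_connected; first exact: segment_connected.
  exact: continuous_subspaceT.
Qed.

Lemma continuous_fst (R : realType) : continuous (@fst R R).
Proof. by move=> p; exact: cvg_fst. Qed.

Lemma continuous_snd (R : realType) : continuous (@snd R R).
Proof. by move=> p; exact: cvg_snd. Qed.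

(** * Pseudo-lines in charts *)

(* [chart i] straightens the [i]-th pseudo-line to the first axis, and
   [vx i j] is the abscissa, in that chart, of its crossing with the [j]-th. *)
Record charted_lines (R : realType) (n : nat) := ChartedLines {
  chart : 'I_n -> R * R -> R * R;
  param : 'I_n -> R * R -> R * R;
  chart_continuous : forall i, continuous (chart i);
  param_continuous : forall i, continuous (param i);
  chartK : forall i, cancel (chart i) (param i);
  paramK : forall i, cancel (param i) (chart i);
  vx : 'I_n -> 'I_n -> R;
  vx_meet : forall i j, i != j -> param i (vx i j, 0) = param j (vx j i, 0);
  vx_crossing : forall i j u u', i != j -> u < vx i j -> vx i j < u' ->
    (chart j (param i (u, 0))).2 * (chart j (param i (u', 0))).2 < 0;
  vx_inj : forall i j k, i != j -> i != k -> vx i j = vx i k -> j = k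
}.

Section ChartedLines.
Variables (R : realType) (n : nat) (L : charted_lines R n).
Implicit Types (i j k : 'I_n) (u w x h t : R) (C : set (R * R)) (b : bool).

Notation chart := (chart L).
Notation param := (param L).
Notation vx := (vx L).

Definition ht i (z : R * R) : R := (chart i z).2.
Definition pos i (z : R * R) : R := (chart i z).1.
Definition pt i u : R * R := param i (u, 0).

Lemma ht_continuous i : continuous (ht i).
Proof.
move=> z; apply: continuous_comp; first exact: chart_continuous.
exact: continuous_snd.
Qed.

Lemma pos_continuous i : continuous (pos i).
Proof.
move=> z; apply: continuous_comp; first exact: chart_continuous.
exact: continuous_fst.
Qed.

Lemma ht_param i (p : R * R) : ht i (param i p) = p.2.
Proof. by rewrite /ht paramK. Qed.

Lemma pos_param i (p : R * R) : pos i (param i p) = p.1.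
Proof. by rewrite /pos paramK. Qed.

Lemma param_pos_ht i z : param i (pos i z, ht i z) = z.
Proof. by rewrite /pos /ht -surjective_pairing chartK. Qed.

Lemma pt_pos i z : ht i z = 0 -> pt i (pos i z) = z.
Proof. by move=> h0; rewrite /pt -[X in (_, X)]h0 param_pos_ht. Qed.

Lemma pt_continuous i : continuous (pt i).
Proof.
move=> u; apply: (@continuous_comp _ _ _ (fun u => (u, 0)) (param i)).
  have id_cvg : x @[x --> u] --> u by exact: cvg_id.
  exact: cvg_pair id_cvg (cvg_cst 0).
exact: param_continuous.
Qed.

Lemma vx_neq i j k : i != j -> i != k -> j != k -> vx i j != vx i k.
Proof. by move=> ij ik; apply: contra_neq => /(vx_inj ij ik). Qed.

Lemma ht_pt_vx i j : i != j -> ht j (pt i (vx i j)) = 0.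
Proof. by move=> ij; rewrite /ht /pt vx_meet // paramK. Qed.

Lemma ht_pt_opp i j u u' : i != j ->
  (u - vx i j) * (u' - vx i j) < 0 -> ht j (pt i u) * ht j (pt i u') < 0.
Proof.
move=> ij uu'; have [uv|uv|uv] := ltgtP u (vx i j).
- have vu' : vx i j < u' by nra.
  exact: vx_crossing ij uv vu'.
- have vu' : u' < vx i j by nra.
  by rewrite mulrC; exact: vx_crossing ij vu' uv.
- by move: uu'; rewrite uv subrr mul0r ltxx.
Qed.

(** The mirror image of [u] in [vx i j] lies beyond the crossing, and a negative product has no zero
    factor. *)
Lemma ht_pt_neq0 i j u : i != j -> u != vx i j -> ht j (pt i u) != 0.
Proof.
move=> ij uv.
have /(ht_pt_opp ij) : (u - vx i j) * (vx i j - (u - vx i j) - vx i j) < 0.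
  have : 0 < (u - vx i j) ^+ 2 by rewrite exprn_even_gt0 // subr_eq0.
  by nra.
by apply: contraTneq => ->; rewrite mul0r ltxx.
Qed.

(** The mirror image of [u] in [vx i j] has a height opposite in sign to those at both [u] and
    [u']. *)
Lemma ht_pt_same i j u u' : i != j ->
  0 < (u - vx i j) * (u' - vx i j) -> 0 < ht j (pt i u) * ht j (pt i u').
Proof.
move=> ij uu'.
have uN : u - vx i j != 0 by apply: contraTneq uu' => ->; rewrite mul0r ltxx.
set v' := vx i j - (u - vx i j).
have : 0 < (u - vx i j) ^+ 2 by rewrite exprn_even_gt0.
move=> u2; have h1 : (u - vx i j) * (v' - vx i j) < 0 by rewrite /v'; nra.
have h2 : (u' - vx i j) * (v' - vx i j) < 0 by rewrite /v'; nra.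
move: (ht_pt_opp ij h1) (ht_pt_opp ij h2).
move: (ht j (pt i u)) (ht j (pt i v')) (ht j (pt i u')) => a c d ac dc.
have c2 : 0 < c ^+ 2.
  by rewrite exprn_even_gt0 //=; apply: contraTneq ac => ->; rewrite mulr0 ltxx.
have : 0 < (a * c) * (d * c) by rewrite nmulr_rgt0.
by rewrite (_ : a * c * (d * c) = (a * d) * c ^+ 2); [rewrite pmulr_lgt0|ring].
Qed.

Lemma sign_same (a c : R) : 0 < a * c -> (a < 0) = (c < 0).
Proof. by move=> ac; apply/idP/idP => ?; nra. Qed.

Lemma sign_opp (a c : R) : a * c < 0 -> (a < 0) = ~~ (c < 0).
Proof. by rewrite -leNgt => ac; apply/idP/idP => ?; nra. Qed.

Lemma same_sign (a c : R) : a != 0 -> c != 0 -> (a < 0) = (c < 0) -> 0 < a * c.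
Proof.
by case: (ltgtP a 0) => // a0 _; case: (ltgtP c 0) => // c0 _ _;
  [rewrite nmulr_rgt0|rewrite pmulr_rgt0].
Qed.

Lemma same_vx_side i j u u' : i != j -> u != vx i j -> u' != vx i j ->
  (ht j (pt i u) < 0) = (ht j (pt i u') < 0) -> 0 < (u - vx i j) * (u' - vx i j).
Proof.
move=> ij uv u'v /(same_sign (ht_pt_neq0 ij uv) (ht_pt_neq0 ij u'v)) hh.
rewrite ltNge le_eqVlt mulf_eq0 !subr_eq0 (negPf uv) (negPf u'v) /=.
by apply/negP => /(ht_pt_opp ij) /(lt_trans hh); rewrite ltxx.
Qed.

Definition off : set (R * R) := [set z | forall i, ht i z != 0].

Definition is_face C := exists2 x, off x & C = connected_component off x.

Lemma face_sub C : is_face C -> C `<=` off.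
Proof. by move=> [x _ ->]; exact: connected_component_sub. Qed.

Lemma face_path C (gamma : R -> R * R) (a c : R) : is_face C ->
  continuous gamma -> a <= c -> (forall t, a <= t <= c -> off (gamma t)) ->
  C (gamma a) -> C (gamma c).
Proof. by move=> [x _ ->]; exact: component_path. Qed.

Lemma face_eq C C' z : is_face C -> is_face C' -> C z -> C' z -> C = C'.
Proof.
by move=> [x _ ->] [y _ ->] /same_connected_component -> /same_connected_component.
Qed.

(** The face [C] touches line [i] at abscissa [u], from below in the chart if [b] is true and from
    above otherwise; thus [b] agrees with the test [ht i z < 0]. *)
Definition adj C i u b :=
  exists2 d, 0 < d & forall t, 0 < t -> t < d -> C (param i (u, (-1) ^+ b * t)).

Lemma adj_face_eq C C' i u b : is_face C -> is_face C' ->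
  adj C i u b -> adj C' i u b -> C = C'.
Proof.
move=> fC fC' [d d0 dC] [d' d'0 d'C].
pose t := Num.min d d' / 2.
have t0 : 0 < t by rewrite divr_gt0 // lt_min d0.
have tlt : t < Num.min d d' by rewrite ltr_pdivrMr // ltr_pMr ?lt_min ?d0 // ltr1n.
move: tlt; rewrite lt_min => /andP[td td'].
exact: face_eq fC fC' (dC t t0 td) (d'C t t0 td').
Qed.

Definition free i u := forall j, j != i -> u != vx i j.

(** The finitely many other heights do not vanish at [pt i u], hence by continuity not near it. *)
Lemma free_box i u : free i u -> exists2 r, 0 < r &
  forall x h, `|x - u| < r -> `|h| < r ->
    forall j, j != i -> ht j (param i (x, h)) != 0.
Proof.
move=> fu.
have : nbhs ((u, 0) : R * R) [set p | forall j, j != i -> ht j (param i p) != 0].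
  apply: (@filter_forall _ _ (fun j p => j != i -> ht j (param i p) != 0)
    (nbhs (u, 0 : R)) _) => j.
  have [->|ji] := eqVneq j i.
    by apply: filterE => p /eqP.
  have hN : ht j (param i (u, 0)) != 0 by apply: ht_pt_neq0; [rewrite eq_sym|exact: fu].
  have hc : {for ((u, 0) : R * R), continuous (ht j \o param i)}.
    apply: continuous_comp; first exact: param_continuous.
    exact: ht_continuous.
  by apply: filterS (cvgr_neq0 _ hc hN) => p pN _.
move=> /nbhs_ballP[r r0 hr]; exists r => // x h xu h0.
by apply: hr; split; rewrite /ball /= ?sub0r ?normrN // distrC.
Qed.

Lemma signr_bool (b : bool) : (-1) ^+ b = (if b then -1 else 1) :> R.
Proof. by case: b; rewrite ?expr1 ?expr0. Qed.

(** Only line [i] enters the box, so each of its two halves lies in a single face: a straight chart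
    segment between points on one side of [i] avoids all lines. *)
Lemma box_adj C i u r x h x' : is_face C ->
  (forall x h, `|x - u| < r -> `|h| < r ->
    forall j, j != i -> ht j (param i (x, h)) != 0) ->
  `|x - u| < r -> `|h| < r -> `|x' - u| < r -> h != 0 ->
  C (param i (x, h)) -> adj C i x' (h < 0).
Proof.
move=> fC box xu hr x'u h0 Cxh.
exists r; first exact: le_lt_trans hr.
move=> t t0 tr; set h' := _ * t.
have h'r : `|h'| < r by rewrite normrM normr_sign mul1r gtr0_norm.
have hh' : 0 < h * h'.
  by rewrite /h' signr_bool; case: (ltgtP h 0) h0 => // hlt _;
    rewrite ?mulN1r ?mul1r; [rewrite nmulr_rgt0 // oppr_lt0|exact: mulr_gt0].
have -> : param i (x', h') = param i (segment_path (x, h) (x', h') 1).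
  by rewrite segment_path1.
apply: (@face_path _ (param i \o segment_path (x, h) (x', h')) 0 1) => //.
- move=> s; apply: continuous_comp; first exact: segment_path_continuous.
  exact: param_continuous.
- move=> s s01 j /=; have [->|ji] := eqVneq j i.
    rewrite ht_param /segment_path /=; move: hh'; have [hlt|hlt|->] := ltgtP h 0.
    + by rewrite nmulr_rgt0 // => h'0; rewrite lt_eqF // convex_lt.
    + by rewrite pmulr_rgt0 // => h'0; rewrite gt_eqF // convex_gt.
    + by rewrite mul0r ltxx.
  apply: (box) => //=; move: xu hr x'u h'r;
    rewrite !ltr_norml => /andP[? ?] /andP[? ?] /andP[? ?] /andP[? ?].
    rewrite addrAC (_ : x' - x = (x' - u) - (x - u)); last by ring.
    by rewrite convex_gt // convex_lt.
  by rewrite convex_gt // convex_lt.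
- by rewrite /= segment_path0.
Qed.

End ChartedLines.

(** * Faces along a line *)

Section AdjacentFaces.
Variables (R : realType) (n : nat) (L : charted_lines R n).
Implicit Types (i j k : 'I_n) (u w x h t : R) (C : set (R * R)) (b : bool).

Notation chart := (chart L).
Notation param := (param L).
Notation vx := (vx L).
Notation ht := (ht L).
Notation pos := (pos L).
Notation pt := (pt L).
Notation is_face := (is_face L).
Notation adj := (adj L).
Notation free := (free L).

Lemma sign_lt0 (b : bool) t : 0 < t -> ((-1) ^+ b * t < 0) = b.
Proof. by move=> t0; rewrite signr_bool; case: b; lra. Qed.

Lemma adj_close C i u b (e : R) : adj C i u b -> 0 < e ->
  exists h, [/\ `|h| < e, h != 0, (h < 0) = b & C (param i (u, h))].
Proof.
move=> [d d0 dC] e0; have de : 0 < Num.min d e by rewrite lt_min d0.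
pose t := Num.min d e / 2.
have t0 : 0 < t by rewrite divr_gt0.
have : t < Num.min d e by rewrite /t; lra.
rewrite lt_min => /andP[td te].
exists ((-1) ^+ b * t); split; last exact: dC.
- by rewrite normrM normr_sign mul1r gtr0_norm.
- by rewrite mulf_neq0 // ?signr_eq0 // gt_eqF.
- exact: sign_lt0.
Qed.

(** The hypothesis says that no vertex of [i] lies between [u] and [u']. Around every abscissa in
    between, the box of [free_box] makes adjacency locally constant. *)
Lemma adj_segment C i u u' b : is_face C ->
  (forall k, k != i -> 0 < (vx i k - u) * (vx i k - u')) ->
  adj C i u b -> adj C i u' b.
Proof.
move=> fC vN.
have lc x : (u <= x <= u') || (u' <= x <= u) ->
    exists2 r, 0 < r & forall y, `|y - x| < r -> (adj C i x b <-> adj C i y b).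
  move=> xuu'; have [|r r0 box] := @free_box _ _ L i x.
    by move=> k ki; apply/eqP => xk; have := vN k ki; rewrite -xk;
      case/orP: xuu' => /andP[? ?]; nra.
  have xx : `|x - x| < r by rewrite subrr normr0.
  exists r => // y yx; split=> [/adj_close|/adj_close] /(_ r r0) [h [hr hN <- Ch]].
    exact: (box_adj fC box xx hr yx).
  exact: (box_adj fC box yx hr xx).
have [uu'|/ltW u'u] := leP u u'.
  apply: (iffLR (@locally_constant_segment _ (fun x => adj C i x b) _ _ uu' _)).
  by move=> x xu; apply: lc; rewrite xu.
apply: (iffRL (@locally_constant_segment _ (fun x => adj C i x b) _ _ u'u _)).
by move=> x xu; apply: lc; rewrite xu orbT.
Qed.

(** A point of [C] inside the box around [pt i u] decides the side. *)
Lemma closure_adj C i u : is_face C -> free i u -> closure C (pt i u) ->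
  exists b, adj C i u b.
Proof.
move=> fC fu clC; have [r r0 box] := free_box fu.
have [|z [Cz [/= zu zh]]] := clC (chart i @^-1` ball ((u, 0) : R * R) r).
  apply: (@chart_continuous _ _ L i (pt i u)); rewrite /pt paramK.
  exact: nbhsx_ballx.
exists (ht i z < 0); apply: (@box_adj _ _ L C i u r (pos i z) (ht i z)) => //.
- by rewrite distrC.
- by move: zh; rewrite /ball /= sub0r normrN.
- by rewrite subrr normr0.
- exact: (face_sub fC Cz).
- by rewrite param_pos_ht.
Qed.

Lemma adj_closure C i u b : adj C i u b -> closure C (pt i u).
Proof.
move=> aC B nB; have : nbhs ((u, 0) : R * R) (param i @^-1` B).
  exact: param_continuous.
move=> /nbhs_ballP[r r0 rB]; have [h [hr _ _ Ch]] := adj_close aC r0.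
exists (param i (u, h)); split=> //; apply: rB; split; rewrite /ball /=.
  by rewrite subrr normr0.
by rewrite sub0r normrN.
Qed.


Lemma bounded_sub_compact C : bounded_set C -> exists2 K, compact K & closure C `<=` K.
Proof.
move=> [M [_ /(_ (M + 1)) CM]].
have {}CM z : C z -> `|z| <= M + 1 by apply: CM; rewrite ltrDl.
pose K : set (R * R) := `[- (M + 1), M + 1] `*` `[- (M + 1), M + 1].
have Kc : compact K by apply: compact_setX; exact: segment_compact.
exists K => //; have Kcl : closed K.
  by apply: compact_closed Kc; exact: norm_hausdorff.
rewrite ((closure_id K).1 Kcl); apply: closure_subset => z /CM.
by rewrite prod_normE /= ge_max => /andP[z1 z2]; split; rewrite /= in_itv /= -ler_norml.
Qed.

(** With no vertex on one side of [u], adjacency would extend along a whole ray of [i]. A chart need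
    not preserve boundedness, but [pos i] is bounded on a compact set containing the closure of
    [C]. *)
Lemma adj_bounded_vx C i u b : is_face C -> bounded_set C -> adj C i u b ->
  (exists2 j, j != i & vx i j <= u) /\ (exists2 j, j != i & u <= vx i j).
Proof.
move=> fC bC aC; have [K Kc CK] := bounded_sub_compact bC.
have [M [_ /(_ (M + 1)) KM]] : bounded_set (pos i @` K).
  apply: compact_bounded; apply: continuous_compact => //.
  by apply: continuous_subspaceT => z; exact: pos_continuous.
have {}KM x : adj C i x b -> `|x| <= M + 1.
  move=> ax; apply: KM; first by rewrite ltrDl.
  by exists (pt i x); [apply: CK; exact: adj_closure ax|rewrite /pt pos_param].
split; apply: contrapT => noj.
  suff /KM : adj C i (Num.min u (- (M + 1)) - 1) b.
    rewrite ler_norml => /andP[+ _]; apply/negP; rewrite -ltNge.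
    by rewrite ltrBlDr; apply: (@le_lt_trans _ _ (- (M + 1))); rewrite ?ge_min ?lexx ?orbT ?ltrDl.
  apply: adj_segment aC => // k ki.
  have uk : u < vx i k by rewrite ltNge; apply/negP => ku; apply: noj; exists k.
  have mk : Num.min u (- (M + 1)) - 1 < vx i k.
    by rewrite ltrBlDr (@le_lt_trans _ _ u) ?ge_min ?lexx // ltr_wpDr.
  by rewrite mulr_gt0 // subr_gt0.
suff /KM : adj C i (Num.max u (M + 1) + 1) b.
  rewrite ler_norml => /andP[_]; apply/negP; rewrite -ltNge.
  by rewrite (@le_lt_trans _ _ (Num.max u (M + 1))) ?le_max ?lexx ?orbT ?ltrDl.
apply: adj_segment aC => // k ki.
have uk : vx i k < u by rewrite ltNge; apply/negP => ku; apply: noj; exists k.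
have mk : vx i k < Num.max u (M + 1) + 1.
  by rewrite (@lt_le_trans _ _ u) // (@le_trans _ _ (Num.max u (M + 1))) ?le_max ?lexx ?lerDl.
by rewrite nmulr_rgt0 subr_lt0.
Qed.

End AdjacentFaces.

(** * Corners of faces at a crossing *)

Section Corner.
Variables (R : realType) (n : nat) (L : charted_lines R n).
Implicit Types (i j k : 'I_n) (u w x h t : R) (C : set (R * R)) (b : bool).

Notation chart := (chart L).
Notation param := (param L).
Notation vx := (vx L).
Notation ht := (ht L).
Notation pos := (pos L).
Notation pt := (pt L).
Notation is_face := (is_face L).
Notation adj := (adj L).
Notation free := (free L).

Lemma mul_gt0_trans (x y z : R) : 0 < x * y -> 0 < y * z -> 0 < x * z.
Proof.
case: (ltgtP y 0) => [y0|y0|->]; last by rewrite mulr0 ltxx.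
  by rewrite nmulr_lgt0 // nmulr_rgt0 // => ? ?; rewrite nmulr_rgt0.
by rewrite pmulr_lgt0 // pmulr_rgt0 // => ? ?; rewrite mulr_gt0.
Qed.

Lemma shrink (a r : R) : 0 <= a -> 0 < r ->
  exists s, [/\ 0 < s, s < 1 & s * a < r].
Proof.
move=> a0 r0; have ra : 0 < r + a + 1 by lra.
exists (r / (r + a + 1)); split; first exact: divr_gt0.
  by rewrite ltr_pdivrMr // mul1r; lra.
by rewrite mulrAC ltr_pdivrMr // ltr_pM2l //; lra.
Qed.

(* No crossing on line [i] separates [u] from that with [j]. *)
Definition near_vx i j u := u != vx i j /\
  forall k, k != i -> k != j -> 0 < (vx i k - u) * (vx i k - vx i j).

Lemma near_vx_free i j u : near_vx i j u -> free i u.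
Proof.
move=> [uv uN] k ki; have [->//|kj] := eqVneq k j.
by apply: contraTneq (uN k ki kj) => ->; rewrite subrr mul0r ltxx.
Qed.

Lemma near_vx_segment i j u u' : near_vx i j u -> near_vx i j u' ->
  0 < (u - vx i j) * (u' - vx i j) ->
  forall k, k != i -> 0 < (vx i k - u) * (vx i k - u').
Proof.
move=> [_ uN] [_ u'N] uu' k ki; have [->|kj] := eqVneq k j.
  by rewrite -mulrNN !opprB.
by apply: mul_gt0_trans (uN k ki kj) _; rewrite mulrC; exact: u'N.
Qed.

Lemma near_vx_shrink i j u s : 0 < s -> s < 1 -> near_vx i j u ->
  near_vx i j (vx i j + s * (u - vx i j)).
Proof.
move=> s0 s1 [uv uN]; split.
  by rewrite -subr_eq0 addrC addKr mulf_neq0 ?subr_eq0 // gt_eqF.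
move=> k ki kj; have uk := uN k ki kj.
have k2 : 0 <= (vx i k - vx i j) ^+ 2 by exact: sqr_ge0.
have := mulr_gt0 s0 uk.
have : 0 <= (1 - s) * (vx i k - vx i j) ^+ 2 by rewrite mulr_ge0 // subr_ge0 ltW.
nra.
Qed.

Lemma shrink_same_side (u v s : R) : 0 < s -> u != v ->
  0 < (u - v) * (v + s * (u - v) - v).
Proof.
move=> s0 uv; rewrite (_ : _ * _ = s * (u - v) ^+ 2); last by ring.
by rewrite mulr_gt0 // exprn_even_gt0 //= subr_eq0.
Qed.

Lemma continuous_ball (f : R -> R * R) t (r : R) : {for t, continuous f} -> 0 < r ->
  exists2 d, 0 < d & forall s, `|s - t| < d ->
    `|(f s).1 - (f t).1| < r /\ `|(f s).2 - (f t).2| < r.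
Proof.
move=> fc r0; have := fc (ball (f t) r) (nbhsx_ballx (f t) _ r0).
move=> /nbhs_ballP[d d0 df]; exists d => // s st.
have [|+ +] := df s; first by rewrite /ball /= distrC.
by rewrite /ball /= => ? ?; split; rewrite distrC.
Qed.

(** All conditions are open, finite in number, and hold at the crossing itself. The second one
    ensures that a point where a path in the box hits [j] is next to the crossing along [j]. *)
Lemma vertex_box i j : i != j -> exists2 r, 0 < r &
  forall x h, `|x - vx i j| < r -> `|h| < r ->
    (forall k, k != i -> k != j -> ht k (param i (x, h)) != 0) /\
    (forall k, k != j -> k != i ->
       0 < (vx j k - pos j (param i (x, h))) * (vx j k - vx j i)).
Proof.
move=> ij; pose v0 : R * R := (vx i j, 0).
have ji : j != i by rewrite eq_sym.
have : nbhs v0 [set p | forall k, k != i -> k != j -> ht k (param i p) != 0 /\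
    0 < (vx j k - pos j (param i p)) * (vx j k - vx j i)].
  apply: (@filter_forall _ _ (fun k p => k != i -> k != j ->
    ht k (param i p) != 0 /\
    0 < (vx j k - pos j (param i p)) * (vx j k - vx j i)) (nbhs v0) _) => k.
  have [->|ki] := eqVneq k i; first by apply: filterE => p /eqP.
  have [->|kj] := eqVneq k j; first by apply: filterE => p _ /eqP.
  have hc : {for v0, continuous (ht k \o param i)}.
    apply: continuous_comp; first exact: param_continuous.
    exact: ht_continuous.
  have hN : ht k (param i v0) != 0.
    by apply: ht_pt_neq0; rewrite 1?eq_sym // vx_neq // eq_sym.
  have pc : (vx j k - pos j (param i p)) * (vx j k - vx j i) @[p --> v0] -->
      (vx j k - pos j (param i v0)) * (vx j k - vx j i).
    apply: cvgM; last exact: cvg_cst.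
    apply: cvgB; first exact: cvg_cst.
    apply: (@continuous_comp _ _ _ (param i) (pos j)); first exact: param_continuous.
    exact: pos_continuous.
  have pN : 0 < (vx j k - pos j (param i v0)) * (vx j k - vx j i).
    rewrite /v0 vx_meet // pos_param /= -expr2 exprn_even_gt0 //= subr_eq0.
    by rewrite vx_neq // eq_sym.
  have hN' : \forall p \near v0, ht k (param i p) != 0 by exact: cvgr_neq0 hc hN.
  have pN' : \forall p \near v0,
      0 < (vx j k - pos j (param i p)) * (vx j k - vx j i).
    exact: cvgr_gt pc _ pN.
  by apply: filterS (filterI hN' pN') => p [].
move=> /nbhs_ballP[r r0 rN]; exists r => // x h xv hr.
have {}rN k : k != i -> k != j -> ht k (param i (x, h)) != 0 /\
    0 < (vx j k - pos j (param i (x, h))) * (vx j k - vx j i).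
  by apply: rN; split; rewrite /ball /= ?sub0r ?normrN // distrC.
by split=> k ? ?; have [] := rN k.
Qed.

(* A face touching line [i] next to its crossing with [j] fills the quadrant
   there: a segment, in the chart of [i], from a point of the face to line [j]
   stays in the face until it first meets [j]. *)
Lemma corner C i j u w b : is_face C -> i != j ->
  near_vx i j u -> near_vx j i w -> adj C i u b -> (ht i (pt j w) < 0) = b ->
  adj C j w (ht j (pt i u) < 0).
Proof.
move=> fC ij nu nw aC wb; have ji : j != i by rewrite eq_sym.
have [r r0 rN] := vertex_box ij.
set v := vx i j in rN *; set v' := vx j i in rN *.
(* The path starts over [x], which is [u] pulled towards the crossing into the box, at a height [h]
   in the face and too small to change the side of [j]. *)
have [s [s0 s1 sr]] := shrink (normr_ge0 (u - v)) r0.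
set x := v + s * (u - v).
have uv : u != v by case: nu.
have wv' : w != v' by case: nw.
have nx : near_vx i j x by exact: near_vx_shrink.
have aCx : adj C i x b.
  by apply: adj_segment aC => //; apply: near_vx_segment nu nx _; exact: shrink_same_side.
have xu : (ht j (pt i u) < 0) = (ht j (pt i x) < 0).
  by apply: sign_same; apply: ht_pt_same => //; exact: shrink_same_side.
have xr : `|x - v| < r by rewrite /x addrC addKr normrM gtr0_norm.
have [|r1 r10 r1h] := @continuous_neq0_near _ (fun h => ht j (param i (x, h))) 0 _
    (ht_pt_neq0 ij nx.1).
  move=> h; apply: (@continuous_comp _ _ _ (fun h => param i (x, h)) (ht j)).
    apply: (@continuous_comp _ _ _ (fun h => (x, h)) (param i)).
      have id_cvg : y @[y --> h] --> h by exact: cvg_id.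
      exact: cvg_pair (cvg_cst x) id_cvg.
    exact: param_continuous.
  exact: ht_continuous.
have [|h [+ hN hb Ch]] := @adj_close _ _ L C i x b (Num.min r r1) aCx.
  by rewrite lt_min r0.
rewrite lt_min => /andP[hr hr1].
have {r1h} hx : (ht j (pt i x) < 0) = (ht j (param i (x, h)) < 0).
  by apply: sign_same; apply: r1h; rewrite subr0.
(* The path ends at [pt j w0], where [w0] is [w] pulled towards the crossing until the point lies in
   the box as seen in the chart of [i]. *)
have [|r2 r20 r2w] := @continuous_ball (chart i \o pt j) v' r _ r0.
  by apply: continuous_comp; [exact: pt_continuous|exact: chart_continuous].
have [s' [s'0 s'1 s'r]] := shrink (normr_ge0 (w - v')) r20.
set w0 := v' + s' * (w - v').
have [|+ +] := r2w w0; first by rewrite /w0 addrC addKr normrM gtr0_norm.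
rewrite /= /pt /v' -vx_meet // paramK /= subr0 -/v -/v' -/(pt j w0) => w0v w0r.
have w0b : (ht i (pt j w0) < 0) = b.
  rewrite -wb; apply/esym/sign_same; apply: ht_pt_same => //.
  exact: shrink_same_side.
have w0N : ht i (pt j w0) != 0.
  by apply: ht_pt_neq0 => //; case: (near_vx_shrink s'0 s'1 nw).
pose p := segment_path (x, h) (chart i (pt j w0)).
(* Both ends are in the box and on side [b] of [i], hence so is the whole path; the only line that
   it can meet is [j]. *)
have pr y : 0 <= y <= 1 ->
    [/\ `|(p y).1 - v| < r, `|(p y).2| < r, (p y).2 != 0 & ((p y).2 < 0) = b].
  move=> y01; rewrite /p /segment_path /= -/(ht i (pt j w0)).
  have pb : 0 < h * ht i (pt j w0) by apply: same_sign; rewrite // hb.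
  have ph : 0 < h * (h + y * (ht i (pt j w0) - h)).
    move: pb; have [hlt|hlt|hz] := ltgtP h 0.
    - by rewrite !nmulr_rgt0 // => ?; rewrite convex_lt.
    - by rewrite !pmulr_rgt0 // => ?; rewrite convex_gt.
    - by rewrite hz mul0r ltxx.
  split.
  - move: xr w0v; rewrite !ltr_norml => /andP[? ?] /andP[? ?].
    rewrite addrAC (_ : _ - x = ((chart i (pt j w0)).1 - v) - (x - v)); last by ring.
    by rewrite convex_gt // convex_lt.
  - move: hr w0r; rewrite !ltr_norml => /andP[? ?] /andP[? ?].
    by rewrite convex_gt // convex_lt.
  - by apply: contraTneq ph => ->; rewrite mulr0 ltxx.
  - by rewrite -hb; apply/esym/sign_same.
pose gamma := param i \o p.
have gammac : continuous gamma.
  move=> y; apply: continuous_comp; first exact: segment_path_continuous.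
  exact: param_continuous.
have gammai y : ht i (gamma y) = (p y).2 by rewrite ht_param.
have gammaN y : 0 <= y <= 1 ->
    (forall k, k != i -> k != j -> ht k (gamma y) != 0) /\
    (forall k, k != j -> k != i -> 0 < (vx j k - pos j (gamma y)) * (vx j k - v')).
  by move=> /pr[py1 py2 _ _]; rewrite /gamma /= (surjective_pairing (p y)); exact: rN.
have gammajc : continuous (ht j \o gamma).
  by move=> y; apply: continuous_comp; [exact: gammac|exact: ht_continuous].
have g0 : gamma 0 = param i (x, h) by rewrite /gamma /= /p segment_path0.
have g1 : gamma 1 = pt j w0 by rewrite /gamma /= /p segment_path1 chartK.
have [||t [t0 t1 gt0 gs]] := first_zero gammajc.
- by rewrite /= g0; exact: (face_sub fC Ch).
- by rewrite /= g1 /pt ht_param.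
rewrite /= in gt0 gs.
have Cgamma y : 0 <= y -> y < t -> C (gamma y).
  move=> y0 yt; apply: (face_path fC gammac y0); last by rewrite g0.
  move=> z /andP[z0 zy] k; have zt : z < t by exact: le_lt_trans yt.
  have z01 : 0 <= z <= 1 by rewrite z0 (le_trans (ltW zt)).
  have [->|ki] := eqVneq k i; first by rewrite gammai; case: (pr z z01).
  have [->|kj] := eqVneq k j; last exact: (gammaN z z01).1.
  by have := gs z z0 zt; apply: contraTneq => ->; rewrite mulr0 ltxx.
set w' := pos j (gamma t).
have ptw' : pt j w' = gamma t by exact: pt_pos.
have t01 : 0 <= t <= 1 by rewrite ltW.
have [_ _ ptN ptb] := pr t t01.
have nw' : near_vx j i w'.
  split; last exact: (gammaN t t01).2.
  by apply: contra_neq ptN => w'v'; rewrite -gammai -ptw' w'v' ht_pt_vx.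
(* Slightly before time [t] the path is still in [C], on its initial side of [j], and already in a
   box around [pt j w']; so [C] touches [j] at [w']. *)
have [r3 r30 box] := free_box (near_vx_free nw').
have [|r4 r40 r4t] := @continuous_ball (chart j \o gamma) t r3 _ r30.
  by apply: continuous_comp; [exact: gammac|exact: chart_continuous].
have [q [q0 q1 qt]] := shrink (ltW t0) r40.
have y0 : 0 <= t - q * t by rewrite -{1}[t]mul1r -mulrBl mulr_ge0 // ?subr_ge0 ltW.
have yt : t - q * t < t by rewrite gtrBl mulr_gt0.
have [|] := r4t (t - q * t).
  by rewrite addrC addKr normrN gtr0_norm // mulr_gt0.
rewrite /= -/(pos j _) -/(pos j _) -/(ht j _) -/(ht j _) gt0 subr0 => yp yh.
have gy := gs _ y0 yt.
have aw' : adj C j w' (ht j (pt i u) < 0).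
  rewrite xu hx -g0 (sign_same gy).
  apply: (@box_adj _ _ L C j w' r3 (pos j (gamma (t - q * t)))) => //.
  - by rewrite subrr normr0.
  - by apply: contraTneq gy => ->; rewrite mulr0 ltxx.
  - by rewrite param_pos_ht; exact: Cgamma.
(* Being on the same side of [i], [w'] and [w] lie on the same segment of [j]. *)
apply: adj_segment aw' => //; apply: (near_vx_segment nw' nw).
apply: same_vx_side => //; first by case: nw'.
by rewrite ptw' gammai ptb wb.
Qed.

End Corner.

(** * Triangles *)

Section Triangles.
Variables (R : realType) (n : nat) (L : charted_lines R n).
Implicit Types (i j k : 'I_n) (u w x h t : R) (C D : set (R * R)) (b c : bool).

Notation vx := (vx L).
Notation ht := (ht L).
Notation pt := (pt L).
Notation is_face := (is_face L).
Notation adj := (adj L).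
Notation free := (free L).
Notation near_vx := (near_vx L).

Definition sides C : {set 'I_n} :=
  [set i | `[< exists u b, free i u /\ adj C i u b >]].

Definition is_triangle C := [/\ is_face C, bounded_set C & #|sides C| = 3%N].

Lemma mem_sides C i u b : free i u -> adj C i u b -> i \in sides C.
Proof. by move=> fu aC; rewrite inE; apply/asboolP; exists u, b. Qed.

Lemma near_vx_radius i j : i != j ->
  exists2 r, 0 < r & forall u, u != vx i j -> `|u - vx i j| < r -> near_vx i j u.
Proof.
move=> ij; have : nbhs (vx i j) [set u | forall k, k != i -> k != j ->
    0 < (vx i k - u) * (vx i k - vx i j)].
  apply: (@filter_forall _ _ (fun k u => k != i -> k != j ->
    0 < (vx i k - u) * (vx i k - vx i j)) (nbhs (vx i j)) _) => k.
  have [->|ki] := eqVneq k i; first by apply: filterE => p /eqP.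
  have [->|kj] := eqVneq k j; first by apply: filterE => p _ /eqP.
  have kc : (vx i k - u) * (vx i k - vx i j) @[u --> vx i j] -->
      (vx i k - vx i j) * (vx i k - vx i j).
    apply: cvgM; last exact: cvg_cst.
    by apply: cvgB; [exact: cvg_cst|exact: cvg_id].
  have kN : 0 < (vx i k - vx i j) * (vx i k - vx i j).
    by rewrite -expr2 exprn_even_gt0 //= subr_eq0 vx_neq // eq_sym.
  have kN' : \forall u \near vx i j, 0 < (vx i k - u) * (vx i k - vx i j).
    exact: cvgr_gt kc _ kN.
  by apply: filterS kN'.
move=> /nbhs_ballP[r r0 rN]; exists r => // u uN ur; split=> //.
by apply: rN; rewrite /ball /= distrC.
Qed.

Lemma near_vx_exists i j b : i != j ->
  exists2 u, near_vx i j u & (ht j (pt i u) < 0) = b.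
Proof.
move=> ij; have [r r0 rN] := near_vx_radius ij.
have nr (e : R) : e != 0 -> `|e| < r -> near_vx i j (vx i j + e).
  by move=> e0 er; apply: rN; [rewrite -subr_eq0|]; rewrite addrC addKr.
have r2 : `|r / 2| < r by rewrite gtr0_norm; lra.
have e0 : r / 2 != 0 by rewrite gt_eqF //; lra.
have /sign_opp : ht j (pt i (vx i j + r / 2)) * ht j (pt i (vx i j + - (r / 2))) < 0.
  by apply: ht_pt_opp => //; nra.
have [] := eqVneq (ht j (pt i (vx i j + r / 2)) < 0) b => [hb _|hb opp].
  by exists (vx i j + r / 2) => //; exact: nr.
exists (vx i j + - (r / 2)); first by apply: nr; rewrite ?oppr_eq0 ?normrN.
by move: hb; rewrite opp; case: (_ < 0); case: b.
Qed.

(** The sign of [s] is a direction along [i]; among the vertices ahead, one that minimises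
    [s * (vx i j - u)] comes next. *)
Lemma next_vx i u (s : R) : free i u -> s != 0 ->
  (exists2 j, j != i & 0 < s * (vx i j - u)) ->
  exists j, [/\ j != i, 0 < s * (vx i j - u) & near_vx i j u].
Proof.
move=> fu s0 [j0 j0i sj0].
pose P j := (j != i) && (0 < s * (vx i j - u)).
have Pj0 : P j0 by rewrite /P j0i.
case: (@arg_minP _ _ _ j0 P (fun j => s * (vx i j - u)) Pj0) => j /andP[ji sj] jmin.
exists j; split=> //; split; first exact: fu.
move=> k ki kj.
have vN : vx i k - vx i j != 0 by rewrite subr_eq0 vx_neq // eq_sym.
have uN : vx i k - u != 0 by rewrite subr_eq0 eq_sym fu.
have vkj : vx i k - vx i j = (vx i k - u) - (vx i j - u) by ring.
have [sk|sk] := ltP 0 (s * (vx i k - u)).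
  have := jmin k; rewrite /P ki sk => /(_ isT) jk.
  have {}jk : 0 < s * (vx i k - vx i j).
    rewrite lt_neqAle eq_sym mulf_neq0 //=.
    by rewrite vkj mulrBr subr_ge0.
  by apply: mul_gt0_trans jk; rewrite mulrC.
have {}sk : s * (vx i k - u) < 0 by rewrite lt_neqAle sk mulf_neq0.
have jk : s * (vx i k - vx i j) < 0.
  by rewrite vkj mulrBr subr_lt0 (lt_trans sk).
by apply: (@mul_gt0_trans _ _ (- s)); rewrite ?mulrN ?mulNr oppr_gt0 // mulrC.
Qed.

Lemma bounded_next_vx C i u b (s : R) : is_face C -> bounded_set C ->
  free i u -> adj C i u b -> s != 0 ->
  exists j, [/\ j != i, 0 < s * (vx i j - u) & near_vx i j u].
Proof.
move=> fC bC fu aC s0; apply: next_vx => //.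
have [[j ji ju] [k ki ku]] := adj_bounded_vx fC bC aC.
have {}ju : vx i j - u < 0 by rewrite subr_lt0 lt_neqAle eq_sym fu.
have {}ku : 0 < vx i k - u by rewrite subr_gt0 lt_neqAle fu.
have [sn|sp|sz] := ltgtP s 0; last by rewrite sz eqxx in s0.
  by exists j => //; rewrite nmulr_rgt0.
by exists k => //; rewrite pmulr_rgt0.
Qed.

Lemma corner_exists C i j u b : is_face C -> i != j -> near_vx i j u ->
  adj C i u b ->
  exists w, [/\ near_vx j i w, (ht i (pt j w) < 0) = b &
    adj C j w (ht j (pt i u) < 0)].
Proof.
move=> fC ij nu aC; have [|w nw wb] := @near_vx_exists j i b.
  by rewrite eq_sym.
by exists w; split=> //; exact: corner aC wb.
Qed.

(* The third side of a triangle over a segment of [i] with ends on [j1] and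
   [j2] can only be reached at the apex, which hence lies on the same side. *)
Lemma triangle_apex C i j1 j2 u b : is_triangle C -> free i u -> adj C i u b ->
  j1 != i -> j2 != i -> j1 != j2 -> near_vx i j1 u -> near_vx i j2 u ->
  (ht i (pt j1 (vx j1 j2)) < 0) = b.
Proof.
move=> [fC bC C3] fu aC j1i j2i j12 n1 n2.
have ij1 : i != j1 by rewrite eq_sym.
have ij2 : i != j2 by rewrite eq_sym.
have [w [nw wb aw]] := corner_exists fC ij1 n1 aC.
have [w2 [nw2 _ aw2]] := corner_exists fC ij2 n2 aC.
have fw := near_vx_free nw.
(* The sign of [w - vx j1 i] is the direction along [j1] away from [i]. The next vertex [k] that way
   is a further corner of [C], and the crossing with [i] lies behind. *)
have s0 : w - vx j1 i != 0 by rewrite subr_eq0; case: nw.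
have [k [kj1 ks nk]] := bounded_next_vx fC bC fw aw s0.
have j1k : j1 != k by rewrite eq_sym.
have [w3 [nw3 _ aw3]] := corner_exists fC j1k nk aw.
have s2 : 0 < (w - vx j1 i) ^+ 2 by rewrite exprn_even_gt0.
have ki : k != i.
  by apply: contraTneq ks => ->; rewrite -leNgt -[vx j1 i - w]opprB mulrN -expr2 oppr_le0 ltW.
(* Otherwise [i], [j1], [j2] and [k] would be four sides of [C]. *)
have kj2 : k = j2.
  apply/eqP/negPn/negP => kj2.
  have : (#|[set i; j1; j2; k]%SET| <= #|sides C|)%N.
    apply: subset_leq_card; apply/fintype.subsetP => l.
    rewrite 3!finset.in_setU !finset.in_set1 => /orP[/orP[/orP[]|]|] /eqP ->.
    - exact: mem_sides fu aC.
    - exact: mem_sides fw aw.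
    - exact: mem_sides (near_vx_free nw2) aw2.
    - exact: mem_sides (near_vx_free nw3) aw3.
  rewrite C3 -!finset.setUA !cardsU1 !inE cards1.
  by rewrite (negPf ij1) (negPf ij2) (eq_sym i k) (negPf ki) (negPf j12) (negPf j1k)
    (eq_sym j2 k) (negPf kj2).
(* Seen from [i] along [j1], the apex lies beyond [w], hence on the same side of [i]. *)
rewrite -wb; apply: sign_same; apply: ht_pt_same => //.
rewrite -kj2 mulrC; apply: lt_trans (_ : 0 < (w - vx j1 i) * (vx j1 k - w)) _ => //.
by rewrite -subr_gt0 -mulrBr (_ : _ - _ - _ = w - vx j1 i) -?expr2 //; ring.
Qed.

(** By [triangle_apex] both sides are that of the apex, which is determined by the ends of the
    segment alone. *)
Lemma triangle_one_side C D i u b c : is_triangle C -> is_triangle D ->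
  free i u -> adj C i u b -> adj D i u c -> b = c.
Proof.
move=> tC tD fu aC aD; have [fC bC _] := tC.
have [j1 [j1i s1 n1]] := bounded_next_vx fC bC fu aC (oner_neq0 R).
have [|j2 [j2i s2 n2]] := bounded_next_vx fC bC fu aC (_ : -1 != 0).
  by rewrite oppr_eq0 oner_neq0.
have j12 : j1 != j2 by apply: contraTneq s1 => ->; rewrite -leNgt; lra.
by rewrite -(triangle_apex tC fu aC j1i j2i j12 n1 n2)
  -(triangle_apex tD fu aD j1i j2i j12 n1 n2).
Qed.

Lemma triangle_unique C D i u b c : is_triangle C -> is_triangle D ->
  free i u -> adj C i u b -> adj D i u c -> C = D.
Proof.
move=> tC tD fu aC aD; have bc := triangle_one_side tC tD fu aC aD.
by case: tC tD aD => [fC _ _] [fD _ _]; rewrite -bc; exact: adj_face_eq.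
Qed.

(** If [C] and [D] were on the same side of [i], [corner] would place them on the two sides of one
    segment of [j], against [triangle_one_side]. *)
Lemma triangle_alternate C D i j u u' b c : is_triangle C -> is_triangle D ->
  i != j -> near_vx i j u -> near_vx i j u' ->
  (u - vx i j) * (u' - vx i j) < 0 -> adj C i u b -> adj D i u' c -> c = ~~ b.
Proof.
move=> tC tD ij nu nu' uu' aC aD; have [cb|] := eqVneq c b; last by case: (b) (c) => [] [].
exfalso; rewrite cb {cb} in aD.
have [|w nw wb] := @near_vx_exists j i b; first by rewrite eq_sym.
have fw := near_vx_free nw.
have aCw : adj C j w (ht j (pt i u) < 0) by case: tC => fC _ _; exact: corner aC wb.
have aDw : adj D j w (ht j (pt i u') < 0) by case: tD => fD _ _; exact: corner aD wb.
have := triangle_one_side tC tD fw aCw aDw.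
by rewrite (sign_opp (ht_pt_opp ij uu')); case: (_ < 0).
Qed.

(** By [corner], [D] would also touch [i] beside the crossing, on the side away from [C]: either
    along the segment that [C] borders, against [triangle_one_side], or along the ray past the
    extreme vertex, against boundedness. *)
Lemma no_triangle_past_end C D i j u w b c : is_triangle C -> is_triangle D ->
  i != j -> near_vx i j u -> adj C i u b ->
  (forall k, k != i -> 0 <= (vx i k - vx i j) * (u - vx i j)) ->
  near_vx j i w -> (ht i (pt j w) < 0) = ~~ b -> ~ adj D j w c.
Proof.
move=> tC tD ij nu aC uend nw wb aD; have [fD bD _] := tD.
have ji : j != i by rewrite eq_sym.
have aDi u0 : near_vx i j u0 -> (ht j (pt i u0) < 0) = c -> adj D i u0 (~~ b).
  by move=> nu0 u0c; rewrite -wb; exact: corner aD u0c.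
have [uc|uc] := eqVneq (ht j (pt i u) < 0) c.
  by have := triangle_one_side tC tD (near_vx_free nu) aC (aDi u nu uc); case: (b).
have [u0 nu0 u0c] := near_vx_exists c ij.
have uu0 : (u0 - vx i j) * (u - vx i j) < 0.
  rewrite ltNge le_eqVlt eq_sym mulf_eq0 !subr_eq0.
  rewrite (negPf nu.1) (negPf nu0.1) /=; apply/negP => /(ht_pt_same ij)/sign_same.
  by rewrite u0c => cu; rewrite -cu eqxx in uc.
have s0 : u0 - vx i j != 0 by rewrite subr_eq0; case: nu0.
have [k [ki ks _]] := bounded_next_vx fD bD (near_vx_free nu0) (aDi u0 nu0 u0c) s0.
have := uend k ki; rewrite leNgt => /negP; apply.
have [sn|sp|sz] := ltgtP (u0 - vx i j) 0; last by rewrite sz eqxx in s0.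
  rewrite nmulr_rlt0 // in uu0; rewrite nmulr_rgt0 // in ks.
  by rewrite pmulr_llt0 //; lra.
rewrite pmulr_rlt0 // in uu0; rewrite pmulr_rgt0 // in ks.
by rewrite nmulr_llt0 //; lra.
Qed.

End Triangles.

(** * Segments bordering no triangle *)

Section Count.
Variables (R : realType) (n : nat) (L : charted_lines R n).
Implicit Types (i j k : 'I_n) (u w : R) (C D : set (R * R)) (b c : bool).
Implicit Types p : 'I_n * 'I_n.

Notation vx := (vx L).
Notation adj := (adj L).
Notation near_vx := (near_vx L).
Notation is_triangle := (is_triangle L).
Notation sides := (sides L).

(* A segment is the pair of its line and of the line through its left end. *)
Definition on_seg i j u := vx i j < u /\ near_vx i j u.

Lemma on_seg_adj C i j u u' b : is_face L C -> on_seg i j u -> on_seg i j u' ->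
  adj C i u b -> adj C i u' b.
Proof.
move=> fC [ju nu] [ju' nu']; apply: adj_segment => //.
by apply: (near_vx_segment nu nu'); rewrite mulr_gt0 // subr_gt0.
Qed.

Definition borders C p :=
  p.2 != p.1 /\ exists u b, on_seg p.1 p.2 u /\ adj C p.1 u b.

(** A vertex further right rules out the right rays; the left rays, having no left end, are not
    pairs at all. *)
Definition bounded_segs : {set 'I_n * 'I_n} :=
  [set p | (p.2 != p.1) && [exists k, (k != p.1) && (vx p.1 p.2 < vx p.1 k)]].

Definition used_segs : {set 'I_n * 'I_n} :=
  [set p | `[< exists2 C, is_triangle C & borders C p >]].

Definition unused_segs : {set 'I_n * 'I_n} := bounded_segs :\: used_segs.

Lemma mem_unused_segs p :
  (p \in unused_segs) = (p \notin used_segs) && (p \in bounded_segs).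
Proof. exact: finset.in_setD. Qed.

Lemma mem_bounded_segs i j k : j != i -> k != i -> vx i j < vx i k ->
  (i, j) \in bounded_segs.
Proof. by move=> ji ki jk; rewrite inE ji /=; apply/fintype.existsP; exists k; rewrite ki jk. Qed.

Lemma borders_unique C D p : is_triangle C -> is_triangle D ->
  borders C p -> borders D p -> C = D.
Proof.
move=> tC tD [_ [u [b [su aC]]]] [_ [u' [c [su' aD]]]].
have {}aD : adj D p.1 u c by case: tD => fD _ _; exact: on_seg_adj fD su' su aD.
exact: triangle_unique tC tD (near_vx_free su.2) aC aD.
Qed.

Lemma side_borders C i : is_triangle C -> i \in sides C ->
  exists j, borders C (i, j).
Proof.
move=> [fC bC _]; rewrite inE => /asboolP[u [b [fu aC]]].
have [|j [ji ju nu]] := bounded_next_vx fC bC fu aC (_ : -1 != 0).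
  by rewrite oppr_eq0 oner_neq0.
exists j; split=> //; exists u, b; split=> //; split=> //; lra.
Qed.

Lemma used_bounded : used_segs \subset bounded_segs.
Proof.
apply/fintype.subsetP => -[i j]; rewrite inE => /asboolP[C [fC bC _]].
move=> [/= ji [u [b [[ju nu] aC]]]].
have [k [ki ku _]] := bounded_next_vx fC bC (near_vx_free nu) aC (oner_neq0 R).
by apply: (mem_bounded_segs ji ki); lra.
Qed.

(** Sending a segment to its line covers the three sides of [C]. *)
Lemma card_borders C : is_triangle C -> (3 <= #|[set p | `[< borders C p >]]%SET|)%N.
Proof.
move=> tC; have [_ _ <-] := tC.
apply: leq_trans (leq_imset_card fst _); apply: subset_leq_card.
apply/fintype.subsetP => i /(side_borders tC)[j Cij].
by apply/imsetP; exists (i, j) => //; rewrite inE; apply/asboolP.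
Qed.

(** Distinct triangles border disjoint sets of segments, by [borders_unique]. *)
Lemma triangles_used (s : seq (set (R * R))) : uniq s ->
  (forall C, C \in s -> is_triangle C) -> (3 * size s <= #|used_segs|)%N.
Proof.
move=> us ts.
pose U s : {set 'I_n * 'I_n} := [set p | has (fun C => `[< borders C p >]) s]%SET.
apply: (@leq_trans #|U s|); last first.
  apply: subset_leq_card; apply/fintype.subsetP => p; rewrite !inE.
  by move=> /hasP[C Cs /asboolP Cp]; exists C => //; exact: ts.
elim: s us ts => [|C s IHs] /=; first by rewrite muln0.
move=> /andP[Cs us] ts.
have tC : is_triangle C by apply: ts; rewrite inE eqxx.
have tD D : D \in s -> is_triangle D by move=> Ds; apply: ts; rewrite inE Ds orbT.
have -> : U (C :: s) = [set p | `[< borders C p >]]%SET :|: U s.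
  by apply/setP => p; rewrite !inE.
rewrite cardsU (_ : _ :&: _ = finset.set0).
  by rewrite cards0 subn0 mulnS leq_add ?card_borders // IHs.
apply/setP => p; rewrite !inE; apply/negP => /andP[/asboolP Cp /hasP[D Ds /asboolP Dp]].
by move: Cs; rewrite (borders_unique tC (tD D Ds) Cp Dp) Ds.
Qed.

(** Among all pairs, the [n] diagonal ones and the [n] right rays, which start at the rightmost
    vertex [m i] of [i], are not bounded segments. *)
Lemma card_bounded_segs : (1 < n)%N -> (#|bounded_segs| + n * 2 <= n * n)%N.
Proof.
move=> n1.
have other i : exists j, j != i.
  have : (0 < #|[set~ i]%SET|)%N by rewrite cardsC1 card_ord -subn1 subn_gt0.
  by move=> /card_gt0P[j]; rewrite !inE => ji; exists j.
have /choice[m mP] i : exists j, j != i /\ forall k, k != i -> vx i k <= vx i j.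
  have [j0 j0i] := other i.
  case: (@arg_maxP _ _ _ j0 (fun j => j != i) (vx i) j0i) => j ji jmax.
  by exists j.
pose D : {set 'I_n * 'I_n} := [set (i, i) | i in 'I_n]%SET.
pose M : {set 'I_n * 'I_n} := [set (i, m i) | i in 'I_n]%SET.
have cD : #|D| = n by rewrite card_imset ?card_ord // => i j [].
have cM : #|M| = n by rewrite card_imset ?card_ord // => i j [].
have DM : D :&: M = finset.set0.
  apply/setP => p; rewrite !inE; apply/negP => /andP[/imsetP[i _ ->] /imsetP[j _]].
  by move=> [-> jm]; have [] := mP j; rewrite -jm eqxx.
have DMB : D :|: M \subset ~: bounded_segs.
  apply/fintype.subsetP => p; rewrite !inE => /orP[] /imsetP[i _ ->] /=.
    by rewrite eqxx.
  have [mi mmax] := mP i; rewrite mi /=; apply/fintype.existsP => -[k /andP[ki]].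
  by rewrite ltNge mmax.
have := subset_leq_card DMB; rewrite cardsU DM cards0 subn0 cD cM.
have := cardsC bounded_segs; rewrite card_prod card_ord => <-.
by rewrite muln2 -addnn leq_add2l.
Qed.

End Count.

(** * Lines all of whose bounded segments border triangles *)

Section FullLines.
Variables (R : realType) (n : nat) (L : charted_lines R n).
Hypotheses (n_gt2 : (2 < n)%N) (n_even : ~~ odd n).
Implicit Types (i j k l : 'I_n) (u w : R) (C D : set (R * R)) (b c d : bool).
Implicit Types p : 'I_n * 'I_n.

Notation vx := (vx L).
Notation ht := (ht L).
Notation pt := (pt L).
Notation adj := (adj L).
Notation free := (free L).
Notation near_vx := (near_vx L).
Notation is_triangle := (is_triangle L).
Notation bounded_segs := (bounded_segs L).
Notation used_segs := (used_segs L).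
Notation unused_segs := (unused_segs L).

Definition full i := forall j, (i, j) \in bounded_segs -> (i, j) \in used_segs.

Lemma full_adj i u : full i -> free i u ->
  (exists2 j, j != i & vx i j < u) -> (exists2 j, j != i & u < vx i j) ->
  exists C b, is_triangle C /\ adj C i u b.
Proof.
move=> fi fu [j0 j0i j0u] [k ki ku].
have [||j [ji ju nu]] := @next_vx _ _ L i u (-1) fu.
- by rewrite oppr_eq0 oner_neq0.
- by exists j0 => //; lra.
have {}ju : vx i j < u by lra.
have /fi : (i, j) \in bounded_segs.
  by apply: (mem_bounded_segs ji ki); exact: lt_trans ku.
rewrite inE => /asboolP[C tC [_ [u' [b [su' aC]]]]].
exists C, b; split=> //; case: tC => fC _ _.
exact: (on_seg_adj fC su' (conj ju nu) aC).
Qed.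

Definition between i u u' : {set 'I_n} :=
  [set k | (k != i) && (u < vx i k < u')]%SET.

Lemma between_split i j u u' u'' : j != i -> u < vx i j -> vx i j < u' ->
  u < u'' -> u'' < vx i j -> near_vx i j u' -> near_vx i j u'' ->
  #|between i u u'| = #|between i u u''|.+1.
Proof.
move=> ji uj ju' uu'' u''j nu' nu''.
rewrite (cardsD1 j) inE ji uj ju' add1n; congr _.+1.
apply: eq_card => k; rewrite !inE.
have [->|kj] := eqVneq k j; first by rewrite (ltNge _ u'') (ltW u''j) !andbF.
have [//|ki] /= := eqVneq k i.
have := nu'.2 k ki kj; have := nu''.2 k ki kj => k'' k'; congr (_ && _).
by apply/idP/idP => ?; nra.
Qed.

(** Induction on the number of vertices passed: stepping back over the last one before [u'] flips
    the side. The vertex left of [u] ensures that the intermediate points lie on bounded segments,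
    where fullness supplies a triangle. *)
Lemma alternation i u u' C D b c : full i -> is_triangle C -> is_triangle D ->
  u < u' -> free i u -> free i u' -> adj C i u b -> adj D i u' c ->
  (exists2 j, j != i & vx i j < u) ->
  c = b (+) odd #|between i u u'|.
Proof.
move=> fi tC tD; move: {2}#|_| (erefl #|between i u u'|) => m.
elim: m u' D c tD => [|m IHm] u' D c tD card_m uu' fu fu' aC aD left_u.
  rewrite card_m addbF; apply/esym.
  apply: (triangle_one_side tC tD fu') => //.
  case: tC => fC _ _; apply: adj_segment aC => // k ki.
  have := card0_eq card_m k; rewrite !inE ki /= => /negbT.
  rewrite negb_and -!leNgt => /orP[ku|ku].
    have {}ku : vx i k < u by rewrite lt_neqAle ku eq_sym fu.
    by rewrite nmulr_rgt0 subr_lt0 // (lt_trans ku).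
  have {}ku : u' < vx i k by rewrite lt_neqAle ku fu'.
  by rewrite pmulr_rgt0 subr_gt0 // (lt_trans uu').
have [k] : exists k, k \in between i u u' by apply/card_gt0P; rewrite card_m.
rewrite inE => /and3P[ki uk ku'].
have [||j [ji ju nu']] := @next_vx _ _ L i u' (-1) fu'.
- by rewrite oppr_eq0 oner_neq0.
- by exists k => //; lra.
have {}ju : vx i j < u' by lra.
have uj : u < vx i j.
  have [<-//|kj] := eqVneq k j; have := nu'.2 k ki kj => kk.
  by apply: (lt_trans uk); nra.
have ij : i != j by rewrite eq_sym.
have [r r0 rN] := near_vx_radius L ij.
pose e := Num.min r (vx i j - u) / 2.
(* The point [u''] is taken just before the last vertex [j], still right of [u]. *)
have e0 : 0 < e by rewrite divr_gt0 // lt_min r0 subr_gt0.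
have : e < Num.min r (vx i j - u).
  by rewrite ltr_pdivrMr // ltr_pMr ?ltr1n // lt_min r0 subr_gt0.
rewrite lt_min => /andP[er eu].
pose u'' := vx i j - e.
have u''j : u'' < vx i j by rewrite /u''; lra.
have uu'' : u < u'' by rewrite /u''; lra.
have nu'' : near_vx i j u''.
  apply: rN; first by rewrite lt_eqF.
  by rewrite /u'' addrC addKr normrN gtr0_norm.
have [||E [a [tE aE]]] := full_adj fi (near_vx_free nu'').
- by case: left_u => l li lu; exists l => //; exact: lt_trans uu''.
- by exists j.
have card_split := between_split ji uj ju uu'' u''j nu' nu''.
have -> : c = ~~ a.
  apply: (triangle_alternate tE tD ij nu'' nu' _ aE aD).
  by rewrite nmulr_rlt0 ?subr_gt0 ?subr_lt0.
rewrite card_split /= addbN; congr (~~ _).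
apply: (IHm u'' E) => //; last exact: near_vx_free nu''.
by case: card_split; rewrite card_m => -[].
Qed.

(* The ways in which a line is charged to an unused segment [p]: it carries
   [p], or passes through its left end, or through its right end. *)
Definition charged i p (t : 'I_3) :=
  [/\ p \in unused_segs, p.1 != i \/ t = ord0 &
    match val t with
    | 0 => p.1 = i
    | 1 => p.2 = i
    | _ => forall k, k != p.1 -> (vx p.1 k <= vx p.1 p.2) = (vx p.1 k < vx p.1 i)
    end].

(** Only the right end needs an argument: both vertices follow the same set of vertices of [p.1], so
    neither precedes the other, and [vx_inj] identifies their lines. *)
Lemma charged_inj i i' p t : charged i p t -> charged i' p t -> i = i'.
Proof.
move=> [_ + +] [_]; case: t => -[|[|t]] lt3 /=; [by move=> _ -> _ ->|by move=> _ -> _ ->|].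
move=> [pi|//] hi [pi'|//] hi'.
have ii' : (vx p.1 i < vx p.1 i') = (vx p.1 i' < vx p.1 i') by rewrite -hi' ?hi ?ltxx 1?eq_sym.
have i'i : (vx p.1 i' < vx p.1 i) = (vx p.1 i < vx p.1 i) by rewrite -hi ?hi' ?ltxx 1?eq_sym.
by apply: (@vx_inj _ _ L _ _ _ pi pi'); apply: le_anti; rewrite !leNgt ii' i'i !ltxx.
Qed.

Lemma end_segment i j k d : i != j -> k != j -> k != i ->
  (ht i (pt j (vx j k)) < 0) = d ->
  (forall D w c, is_triangle D -> near_vx j i w -> (ht i (pt j w) < 0) = d ->
     ~ adj D j w c) ->
  exists p t, charged i p t.
Proof.
move=> ij kj ki kd noD; have ji : j != i by rewrite eq_sym.
have [w nw wd] := near_vx_exists L d ji.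
have jk : j != k by rewrite eq_sym.
have kw : 0 < (vx j k - vx j i) * (w - vx j i).
  apply: same_vx_side => //; [by rewrite vx_neq|by case: nw|by rewrite wd].
have unused l : vx j l < w -> near_vx j l w -> (j, l) \notin used_segs.
  move=> lw nlw; apply/negP; rewrite inE => /asboolP[D tD [_ [u [c [/= su aD]]]]].
  apply: (noD D w c) => //; case: tD => fD _ _.
  exact: on_seg_adj fD su (conj lw nlw) aD.
(* If the segment runs to the left of [i], then [i] is at its right end and its left end [l] must be
   found; otherwise [i] itself is at the left end. *)
have [wi|wi] : w < vx j i \/ vx j i < w.
  by case: nw => + _; case: ltgtP => //; [left|right].
- have ki' : vx j k < vx j i by move: kw; rewrite nmulr_lgt0 subr_lt0.
  have kw' : vx j k < w by have := nw.2 k kj ki => kk; nra.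
  have [||l [lj lw nlw]] := @next_vx _ _ L j w (-1) (near_vx_free nw).
  + by rewrite oppr_eq0 oner_neq0.
  + by exists k => //; lra.
  have {}lw : vx j l < w by lra.
  exists (j, l), ord_max; split; [|by left|].
    rewrite mem_unused_segs unused //=.
    exact: mem_bounded_segs lj ij (lt_trans lw wi).
  move=> m mj /=; have [->|mi] := eqVneq m i.
    by rewrite ltxx leNgt (lt_trans lw wi).
  have [->|ml] := eqVneq m l; first by rewrite lexx (lt_trans lw wi).
  have := nlw.2 m mj ml; have := nw.2 m mj mi => h1 h2.
  by apply/idP/idP => h; nra.
- have ki' : vx j i < vx j k by move: kw; rewrite pmulr_lgt0 subr_gt0.
  exists (j, i), (inord 1); split; [|by left|by rewrite /= inordK].
  by rewrite mem_unused_segs unused //=; exact: mem_bounded_segs ij kj ki'.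
Qed.

Lemma full_charged i : full i -> exists p t, charged i p t.
Proof.
move=> fi.
have [j0 [k0 [j0i k0i jk0]]] : exists j k, [/\ j != i, k != i & j != k].
  have : (1 < #|[set~ i]%SET|)%N.
    by rewrite cardsC1 card_ord -subn1 ltn_subRL.
  by move=> /card_gt1P[j [k [+ + jk]]]; rewrite !inE => ji ki; exists j, k.
case: (@arg_minP _ _ _ j0 (fun j => j != i) (vx i) j0i) => l li lmin.
case: (@arg_maxP _ _ _ j0 (fun j => j != i) (vx i) j0i) => r ri rmax'.
have rmax k : k != i -> vx i k <= vx i r by exact: rmax'.
have il : i != l by rewrite eq_sym.
have ir : i != r by rewrite eq_sym.
have lr : l != r.
  have : vx i j0 != vx i k0 by rewrite vx_neq // eq_sym.
  apply: contra_neq => lr; apply: le_anti.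
  rewrite (le_trans (rmax j0 j0i)) -?lr ?lmin //=.
  by rewrite (le_trans (rmax k0 k0i)) -?lr ?lmin.
have vlr : vx i l < vx i r by rewrite lt_neqAle vx_neq //= lmin.
have [rl rl0 rlN] := near_vx_radius L il.
have [rr rr0 rrN] := near_vx_radius L ir.
(* A third of the distance leaves room for both [u] and [u'] strictly between the extreme vertices,
   in this order. *)
pose e := Num.min (Num.min rl rr) (vx i r - vx i l) / 3.
have : 0 < Num.min (Num.min rl rr) (vx i r - vx i l).
  by rewrite !lt_min rl0 rr0 subr_gt0.
move=> m0; have e0 : 0 < e by rewrite divr_gt0.
have : e * 2 < Num.min (Num.min rl rr) (vx i r - vx i l) by rewrite /e; lra.
rewrite !lt_min => /andP[/andP[erl err] elr].
pose u := vx i l + e; pose u' := vx i r - e.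
have lu : vx i l < u by rewrite /u; lra.
have u'r : u' < vx i r by rewrite /u'; lra.
have uu' : u < u' by rewrite /u /u'; lra.
have nu : near_vx i l u.
  apply: rlN; first by rewrite gt_eqF.
  by rewrite /u addrC addKr gtr0_norm //; lra.
have nu' : near_vx i r u'.
  apply: rrN; first by rewrite lt_eqF.
  by rewrite /u' addrC addKr normrN gtr0_norm //; lra.
have [||C [b [tC aC]]] := full_adj fi (near_vx_free nu).
- by exists l.
- by exists r => //; exact: lt_trans u'r.
have [||D [c [tD aD]]] := full_adj fi (near_vx_free nu').
- by exists l => //; exact: lt_trans uu'.
- by exists r.
have cb : c = ~~ b.
  rewrite (alternation fi tC tD uu' (near_vx_free nu) (near_vx_free nu') aC aD);
    last by exists l.
  (* All lines but [i], [l] and [r] cross [i] between [u] and [u']. Their number [n - 3] is odd, so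
     the side flips. *)
  have -> : between i u u' = ~: [set i; l; r]%SET.
    apply/setP => k; rewrite !inE.
    have [->//|ki] := eqVneq k i; have [->|kl] /= := eqVneq k l.
      by rewrite (ltNge u) (ltW lu).
    have [->|kr] /= := eqVneq k r; first by rewrite (ltNge _ u') (ltW u'r) andbF.
    have lk : vx i l < vx i k by rewrite lt_neqAle lmin // vx_neq // eq_sym.
    have kr' : vx i k < vx i r by rewrite lt_neqAle rmax // vx_neq // eq_sym.
    have := nu.2 k ki kl; have := nu'.2 k ki kr => h1 h2.
    by apply/andP; split; nra.
  have := cardsC [set i; l; r]%SET; rewrite card_ord -finset.setUA !cardsU1 cards1 !inE.
  rewrite (negPf il) (negPf ir) (negPf lr) /=.
  move=> /(congr1 odd); rewrite oddD (negPf n_even) /=.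
  by case: (odd _) => //; rewrite addbT.
have [lrd|lrd] := eqVneq (ht i (pt l (vx l r)) < 0) (~~ b).
  apply: (end_segment il _ ri lrd); first by rewrite eq_sym.
  move=> E w a tE nw wd; apply: (no_triangle_past_end tC tE il nu aC _ nw wd).
  by move=> k ki; rewrite mulr_ge0 // subr_ge0 ?lmin // ltW.
have {}lrd : (ht i (pt r (vx r l)) < 0) = ~~ c.
  rewrite cb negbK /pt -vx_meet //; move: lrd; rewrite /pt.
  by case: (_ < 0); case: (b).
apply: (end_segment ir lr li lrd) => E w a tE nw wd.
apply: (no_triangle_past_end tD tE ir nu' aD _ nw wd) => k ki.
by rewrite mulr_le0 // subr_le0 ?rmax // ltW.
Qed.

Lemma card_unused_segs : (n <= #|unused_segs| * 3)%N.
Proof.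
have /choice[f fP] i : exists pt, charged i pt.1 pt.2.
  have [[j ij]|noj] := pselect (exists j, (i, j) \in unused_segs).
    by exists ((i, j), ord0); split=> //; right.
  have [j ij|p [t pt]] := @full_charged i; last by exists (p, t).
  by apply/negPn/negP => ju; apply: noj; exists j; rewrite mem_unused_segs ju.
have f_inj : injective f.
  by move=> i i' ii'; apply: charged_inj (fP i) _; rewrite ii'.
rewrite -[X in (X <= _)%N]card_ord -(card_imset _ f_inj).
rewrite -[X in (_ * X)%N]card_ord -cardsT -cardsX; apply: subset_leq_card.
apply/fintype.subsetP => _ /imsetP[i _ ->]; rewrite (surjective_pairing (f i)) finset.in_setX finset.in_setT andbT.
by have [] := fP i.
Qed.

End FullLines.

(** * From arrangements to charts *)

(** The sign of [g] is constant on either side of its only zero, so [x] and [y] lie on different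
    sides and represent the two signs. *)
Lemma crossing_sign (R : realType) (g : R -> R) (v x y u u' : R) :
  continuous g -> (forall z, g z = 0 <-> z = v) -> g x * g y < 0 ->
  u < v -> v < u' -> g u * g u' < 0.
Proof.
move=> gc gv gxy uv vu'.
have same z z' : 0 < (z - v) * (z' - v) -> 0 < g z * g z'.
  have [zz'|/ltW z'z] := leP z z' => h; last rewrite mulrC;
    by apply: continuous_neq0_gt0 => // t /andP[? ?]; apply/eqP => /gv tv; nra.
have trans (a b c : R) : 0 < a * b -> b * c < 0 -> a * c < 0.
  by rewrite -oppr_gt0 -mulrN -[a * c < 0]oppr_gt0 -mulrN; exact: mul_gt0_trans.
have gN z : z = v -> g z = 0 by move=> /gv.
have [xv|xv|xv] := ltgtP x v; last by move: gxy; rewrite (gN x) // mul0r ltxx.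
  have [yv|yv|yv] := ltgtP y v; last by move: gxy; rewrite (gN y) // mulr0 ltxx.
    by have := same x y; rewrite nmulr_rgt0 subr_lt0 // => /(_ yv)/(lt_trans gxy); rewrite ltxx.
  apply: (trans _ (g x)); first by apply: same; rewrite nmulr_rgt0 subr_lt0.
  rewrite mulrC; apply: (trans _ (g y)); last by rewrite mulrC.
  by apply: same; rewrite mulr_gt0 // subr_gt0.
have [yv|yv|yv] := ltgtP y v; last by move: gxy; rewrite (gN y) // mulr0 ltxx.
  apply: (trans _ (g y)); first by apply: same; rewrite nmulr_rgt0 subr_lt0.
  rewrite mulrC; apply: (trans _ (g x)); last by [].
  by apply: same; rewrite mulr_gt0 // subr_gt0.
by have := same x y; rewrite pmulr_rgt0 subr_gt0 // => /(_ yv)/(lt_trans gxy); rewrite ltxx.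
Qed.

Lemma pseudoline_chart (R : realType) (G : set (R * R)) : affine_pseudoline G ->
  exists cp : (R * R -> R * R) * (R * R -> R * R),
    [/\ continuous cp.1, continuous cp.2, cancel cp.1 cp.2, cancel cp.2 cp.1 &
      forall z, G z <-> (cp.1 z).2 = 0].
Proof.
move=> [phi [[phic [psi [psic phiK psiK]]] [a [b [c [abN Gline]]]]]].
have N0 : a ^+ 2 + b ^+ 2 != 0.
  apply: contra_neq abN => /eqP.
  by rewrite paddr_eq0 ?sqr_ge0 // !sqrf_eq0 => /andP[/eqP -> /eqP ->].
have affine_continuous (k l m : R) : continuous (fun p : R * R => k * p.1 + l * p.2 + m).
  move=> p; apply: cvgD; last exact: cvg_cst.
  by apply: cvgD; apply: cvgM; [exact: cvg_cst|exact: cvg_fst|exact: cvg_cst|exact: cvg_snd].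
(* The similarity [T] takes the line [a x + b y = c] to the first axis, and [S] is its inverse. *)
pose T (p : R * R) : R * R := (b * p.1 + - a * p.2 + 0, a * p.1 + b * p.2 + - c).
pose N := a ^+ 2 + b ^+ 2.
pose S (p : R * R) : R * R := (b / N * p.1 + a / N * p.2 + a * c / N,
  - a / N * p.1 + b / N * p.2 + b * c / N).
have Tc : continuous T.
  by move=> p; exact: cvg_pair (affine_continuous _ _ _ p) (affine_continuous _ _ _ p).
have Sc : continuous S.
  by move=> p; exact: cvg_pair (affine_continuous _ _ _ p) (affine_continuous _ _ _ p).
have TK : cancel T S by case=> x y; rewrite /S /T /N /=; congr (_, _); field.
have SK : cancel S T by case=> x y; rewrite /S /T /N /=; congr (_, _); field.
exists (T \o phi, psi \o S); split=> /=.
- by move=> z; apply: continuous_comp; [exact: phic|exact: Tc].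
- by move=> z; apply: continuous_comp; [exact: Sc|exact: psic].
- by move=> z /=; rewrite TK phiK.
- by move=> z /=; rewrite psiK SK.
move=> z; transitivity ((phi @` G) (phi z)).
  by split=> [Gz|[z' Gz' /(can_inj phiK) <-//]]; exists z.
by rewrite Gline /=; split=> [->|]; [rewrite subrr|move=> /eqP; rewrite subr_eq0 => /eqP].
Qed.

Section Arrangement.
Variables (R : realType) (n : nat) (A : set (set (R * R))).
Hypotheses (arrA : affine_arrangement n A) (simA : simple_arrangement A).

Lemma arrangement_charted :
  exists (G : 'I_n -> set (R * R)) (L : charted_lines R n),
    [/\ injective G, forall H, A H <-> exists i, H = G i &
      forall i z, G i z <-> ht L i z = 0].
Proof.
have [An pA mA] := arrA.
have /card_set_bijP[f [fA f_inj f_surj]] : (`I_n #= A)%card by rewrite card_eq_sym.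
pose G (i : 'I_n) := f i.
have AG i : A (G i) by apply: fA; exact: ltn_ord.
have G_inj : injective G.
  by move=> i j ij; apply/val_inj/f_inj => //; rewrite inE /=; exact: ltn_ord.
have GA H : A H <-> exists i, H = G i.
  split=> [AH|[i ->]]; last exact: AG.
  by have [m mn <-] := f_surj H AH; exists (Ordinal mn).
have GN i j : i != j -> G i <> G j by move=> ij /G_inj/eqP; rewrite (negPf ij).
have /choice[cp cpP] i := pseudoline_chart (pA _ (AG i)).
pose ch i := (cp i).1; pose pa i := (cp i).2.
have chc i : continuous (ch i) by case: (cpP i).
have pac i : continuous (pa i) by case: (cpP i).
have chK i : cancel (ch i) (pa i) by case: (cpP i).
have paK i : cancel (pa i) (ch i) by case: (cpP i).
have Gch i z : G i z <-> (ch i z).2 = 0 by case: (cpP i).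
(* The common point of two lines; on the diagonal its value is arbitrary. *)
have /choice[m mP] (ij : 'I_n * 'I_n) : exists p, ij.1 != ij.2 ->
    [/\ G ij.1 p, G ij.2 p & forall q, G ij.1 q -> G ij.2 q -> p = q].
  have [ij12|ij12] := eqVneq ij.1 ij.2; first by exists (0, 0).
  have [[p [[Gp Gp'] pu]] _] := mA _ _ (AG ij.1) (AG ij.2) (GN _ _ ij12).
  by exists p => _; split=> // q Gq Gq'; apply: pu.
pose v i j := (ch i (m (i, j))).1.
have pav i j : i != j -> pa i (v i j, 0) = m (i, j).
  move=> ij; have [/= /Gch m0 _ _] := mP (i, j) ij.
  by rewrite -m0 -surjective_pairing chK.
have mC i j : i != j -> m (i, j) = m (j, i).
  move=> ij; have [/= _ _] := mP (i, j) ij; apply.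
    by have [|] := mP (j, i); rewrite /= 1?eq_sym.
  by have [|] := mP (j, i); rewrite /= 1?eq_sym.
have vmeet i j : i != j -> pa i (v i j, 0) = pa j (v j i, 0).
  by move=> ij; rewrite !pav // 1?eq_sym // mC.
(* Equal abscissae would put one point on three pseudo-lines, against simplicity. *)
have vinj i j k : i != j -> i != k -> v i j = v i k -> j = k.
  move=> ij ik vv; apply/eqP/negPn/negP => jk.
  have mm : m (i, j) = m (i, k) by rewrite -!pav // vv.
  have [/= Gi Gj _] := mP (i, j) ij; have [/= _ Gk _] := mP (i, k) ik.
  have := simA (AG i) (AG j) (AG k) (GN _ _ ij) (GN _ _ jk) (GN _ _ ik).
  by apply/eqP/set0P; exists (m (i, j)); split=> //; rewrite mm.
have crossing i j u u' : i != j -> u < v i j -> v i j < u' ->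
    (ch j (pa i (u, 0))).2 * (ch j (pa i (u', 0))).2 < 0.
  move=> ij; have [_ [x [y [Gx Gy Gjx Gjy xy]]]] :=
    mA _ _ (AG j) (AG i) (not_eq_sym (GN _ _ ij)).
  pose g (t : R) := (ch j (pa i (t, 0))).2.
  have ptx z : G i z -> pa i ((ch i z).1, 0) = z.
    by move=> /Gch z0; rewrite -z0 -surjective_pairing chK.
  apply: (@crossing_sign _ g _ (ch i x).1 (ch i y).1).
  - move=> t; apply: (@continuous_comp _ _ _ (fun t => pa i (t, 0)) (snd \o ch j)).
      apply: (@continuous_comp _ _ _ (fun t => (t, 0)) (pa i)); last exact: pac.
      have id_cvg : z @[z --> t] --> t by exact: cvg_id.
      exact: cvg_pair id_cvg (cvg_cst 0).
    by apply: continuous_comp; [exact: chc|exact: continuous_snd].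
  - move=> t; split=> [/Gch gt|->]; last first.
      by apply/Gch; rewrite pav //; case: (mP (i, j) ij).
    have [/= _ _ mu] := mP (i, j) ij.
    rewrite /v (mu (pa i (t, 0))) ?paK //.
    by apply/Gch; rewrite paK.
  (* If both heights over [j] had the same sign, the straight segment in the chart of [j] would
     connect [x] and [y] off [G j], against [crosses]. *)
  - rewrite /g !ptx //; rewrite ltNge; apply/negP => xy0; apply: xy.
    have {xy0} xyp : 0 < (ch j x).2 * (ch j y).2.
      rewrite lt_neqAle xy0 andbT eq_sym mulf_neq0 //.
        by apply/eqP => /Gch.
      by apply/eqP => /Gch.
    pose p := segment_path (ch j x) (ch j y).
    have <- : pa j (p 1) = y by rewrite /p segment_path1 chK.
    apply: (@component_path _ _ _ (pa j \o p) 0 1 _ ler01).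
    + by move=> t; apply: continuous_comp; [exact: segment_path_continuous|exact: pac].
    + move=> t t01 /Gch; rewrite /= paK /p /segment_path /=.
      move: xyp; have [xn|xp|->] := ltgtP (ch j x).2 0; last by rewrite mul0r ltxx.
        by rewrite nmulr_rgt0 // => yn /eqP; apply/negP; rewrite lt_eqF // convex_lt.
      by rewrite pmulr_rgt0 // => yp /eqP; apply/negP; rewrite gt_eqF // convex_gt.
    + by rewrite /= /p segment_path0 chK; exact: connected_component_refl.
exists G, (ChartedLines chc pac chK paK vmeet crossing vinj).
by split=> // i z; exact: Gch.
Qed.

Variables (G : 'I_n -> set (R * R)) (L : charted_lines R n).
Hypotheses (G_inj : injective G) (GA : forall H, A H <-> exists i, H = G i).
Hypothesis (G_ht : forall i z, G i z <-> ht L i z = 0).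

Lemma off_arrangement : ~` (\bigcup_(H in A) H) = off L.
Proof.
apply/seteqP; split=> z /=.
  by move=> nz i; apply/eqP => /G_ht Gz; apply: nz; exists (G i) => //; apply/GA; exists i.
by move=> oz [H /GA[i ->] /G_ht/eqP]; rewrite (negPf (oz i)).
Qed.

(** A boundary point on [G i] alone is at a free abscissa, where [closure_adj] applies. Conversely,
    a point of adjacency is in the closure of [C] but, being on a line, not in its interior. *)
Lemma side_sides (C : set (R * R)) : is_face L C ->
  side A C = G @` [set i | i \in sides L C].
Proof.
move=> fC; apply/seteqP; split=> [H [/GA[i ->] [z [[clz _] Gz zN]]]|_ [i iC <-]].
  exists i => //; have z0 := (G_ht i z).1 Gz.
  have fu : free L i (pos L i z).
    move=> j ji; apply/eqP => zv.
    have /zN : A (G j) by apply/GA; exists j.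
    have Gjz : G j z.
      by apply/G_ht; rewrite -(pt_pos z0) zv ht_pt_vx // eq_sym.
    by move=> /(_ Gjz)/G_inj/eqP; rewrite (negPf ji).
  have [|b aC] := closure_adj fC fu; first by rewrite pt_pos.
  exact: mem_sides fu aC.
move: iC; rewrite /= inE => /asboolP[u [b [fu aC]]].
split; first by apply/GA; exists i.
have pt0 : ht L i (pt L i u) = 0 by rewrite /pt ht_param.
exists (pt L i u); split; last 1 first.
- move=> _ /GA[j ->] /G_ht/eqP; apply: contraTeq => Gji.
  have ij : i != j by apply: contra_neq Gji => ->.
  by apply: ht_pt_neq0 => //; apply: fu; rewrite eq_sym.
- split; first exact: adj_closure aC.
  by move=> /interior_subset/(face_sub fC)/(_ i); rewrite pt0 eqxx.
- exact/G_ht.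
Qed.

Lemma triangle_is_triangle (C : set (R * R)) : triangle A C -> is_triangle L C.
Proof.
move=> [faceC bC sC].
have fC : is_face L C.
  by case: faceC => x xU ->; exists x; rewrite -off_arrangement.
split=> //; move: sC; rewrite side_sides // => sC.
have {sC} cC : ([set i | i \in sides L C] #= `I_3)%card.
  by apply: card_eq_trans sC; rewrite card_eq_sym; apply: inj_card_eq => i j _ _ /G_inj.
have <- := card_fset_set cC.
rewrite cardE; apply/perm_size/uniq_perm.
- exact: enum_uniq.
- exact: finmap.fset_uniq.
- by move=> i; rewrite mem_enum in_fset_set ?mem_setE //; exists 3%N.
Qed.

End Arrangement.

(** * The final count *)

Theorem theorem1p1 (R : realType) (n : nat) (n_gt0 : (0 < n)%N)
    (n_even : ~~ odd n) (n_neq2 : n <> 2%N) :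
  (max_triangles R n <=
     ((Num.floor (n%:R * (n%:R - 7%:R / 3%:R) / 3%:R : R))%:~R)%:E)%E.
Proof.
(* For two lines the bound would be the floor of -2/9, that is -1, although the number of triangles
   is 0. *)
have n_gt2 : (2 < n)%N by case: n n_gt0 n_even n_neq2 => [|[|[|[]]]].
apply: ge_ereal_sup => _ [A [arrA simA] <-].
have [G [L [G_inj GA G_ht]]] := arrangement_charted arrA simA.
(* With [T] triangles, [U] used and [B] bounded segments: [3 T <= U], [n <= 3 (B - U)] and
   [B + 2 n <= n^2]; together [9 T + 7 n <= 3 n^2]. Stated for finite lists, the bound also yields
   finiteness. *)
have bound (s : seq (set (R * R))) : uniq s -> (forall C, C \in s -> triangle A C) ->
    (9 * size s + 7 * n <= 3 * n * n)%N.
  move=> us ts; have ts' C : C \in s -> is_triangle L C.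
    by move=> /ts; exact: (triangle_is_triangle G_inj GA G_ht).
  have := card_bounded_segs L (ltnW n_gt2); have := card_unused_segs L n_gt2 n_even.
  rewrite /unused_segs cardsD (finset.setIidPr (used_bounded L)).
  have := subset_leq_card (used_bounded L); have := triangles_used us ts'.
  by move: #|bounded_segs L| #|used_segs L| => B U; nia.
have finA : finite_set (triangle A).
  apply: contrapT => /(infinite_set_fset (n * n)%N.+1)[B BA Bn].
  have := bound _ (finmap.fset_uniq B) BA; move: (size _) Bn => m Bn.
  by nia.
rewrite /counting asboolT //; set s := finmap.enum_fset _.
have : (9 * size s + 7 * n <= 3 * n * n)%N.
  apply: bound; first exact: finmap.fset_uniq.
  by move=> C; rewrite in_fset_set // inE.
rewrite lee_fin (_ : (size s)%:R = (size s)%:Z%:~R) // ler_int.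
(* The count is an integer, so it suffices to bound it by the real number [(3 n^2 - 7 n) / 9]. *)
rewrite real_floor_ge_int ?num_real // -(ler_nat R) !natrD !natrM -pmulrn.
lra.
Qed.
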